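(* Let $d\ge2$ and $s>d/2$, and let $(X_m)$, $X_m=\{x_1,\dots,x_m\}\subset\mathbb{S}^d$, be a sequence of QMC designs for $H^s(\mathbb{S}^d)$ with QMC constant $c(s,d)$. There is a constant $\tilde c>0$, depending only on $s$, $d$ and the sequence $(a_\ell^{(s)})$ defining the norm of $H^s(\mathbb{S}^d)$, such that for every $n\ge 0$ and every $m$ in the index set of the sequence for which $$\eta:=\frac{c(s,d)\,\tilde c}{m^{s/d}}(2n+1)^s\sqrt{\frac{Z(d,n)}{|\mathbb{S}^d|}Z(d+1,n)}$$ lies in $(0,1)$, the equal-weight quadrature rule with points $X_m$ satisfies the Marcinkiewicz--Zygmund property with this $\eta$: $$\left|\frac{|\mathbb{S}^d|}{m}\sum_{j=1}^m\chi(x_j)^2-\int_{\mathbb{S}^d}\chi^2\,\mathrm{d}\omega_d\right|\le\eta\int_{\mathbb{S}^d}\chi^2\,\mathrm{d}\omega_d\qquad\text{for all }\chi\in\mathbb{P}_n(\mathbb{S}^d).$$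
   Context: $\mathbb{S}^d$ is the unit sphere in $\mathbb{R}^{d+1}$, $\omega_d$ its (unnormalized) surface measure, $|\mathbb{S}^d|=\int_{\mathbb{S}^d}\mathrm{d}\omega_d$. $\mathbb{P}_n(\mathbb{S}^d)$ is the space of restrictions to $\mathbb{S}^d$ of real polynomials of degree at most $n$; its dimension is $Z(d+1,n)$. For each $\ell\ge0$, $\{Y_{\ell,k}:k=1,\dots,Z(d,\ell)\}$ is an orthonormal basis (in real $L^2(\mathbb{S}^d,\omega_d)$) of the spherical harmonics of exact degree $\ell$; $Z(d,0)=1$ and $Z(d,\ell)=(2\ell+d-1)\frac{\Gamma(\ell+d-1)}{\Gamma(d)\Gamma(\ell+1)}$ for $\ell\ge1$. Put $\hat f_{\ell,k}=\int_{\mathbb{S}^d}fY_{\ell,k}\,\mathrm{d}\omega_d$. For $s>d/2$ fix positive reals $(a_\ell^{(s)})_{\ell\ge0}$ with $a_\ell^{(s)}\asymp(1+\ell)^{-2s}$ (bounded above and below by positive constant multiples, uniformly in $\ell$); $H^s(\mathbb{S}^d)$ is the set of $f\in L^2(\mathbb{S}^d)$ with $\|f\|_{H^s}:=\big(\sum_{\ell\ge0}\sum_{k}\frac{1}{a_\ell^{(s)}}|\hat f_{\ell,k}|^2\big)^{1/2}<\infty$, its elements being identified with their continuous representatives. A sequence of $m$-point configurations $X_m=\{x_1,\dots,x_m\}\subset\mathbb{S}^d$, with $m\to\infty$ along an infinite set of positive integers, is a sequence of QMC designs for $H^s(\mathbb{S}^d)$ if there is $c(s,d)>0$ independent of $m$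 (the QMC constant) with $\left|\frac{|\mathbb{S}^d|}{m}\sum_{j=1}^mf(x_j)-\int_{\mathbb{S}^d}f\,\mathrm{d}\omega_d\right|\le\frac{c(s,d)}{m^{s/d}}\|f\|_{H^s}$ for all $f\in H^s(\mathbb{S}^d)$ and all such $m$. *)

(* Defs.v *)
From HB Require Import structures.
From mathcomp Require Import all_boot all_order all_algebra.
From mathcomp Require Import all_classical all_reals all_analysis.
From mathcomp Require Import measurable_realfun zify.
From mathcomp.multinomials Require mpoly.
Import (canonicals, coercions) mpoly.

Set Implicit Arguments.
Unset Strict Implicit.
Unset Printing Implicit Defensive.

Import Order.TTheory GRing.Theory Num.Theory.
Import numFieldNormedType.Exports.

Local Open Scope classical_set_scope.
Local Open Scope ring_scope.

Definition measure_rV_display : measure_display -> measure_display.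
Proof. exact. Qed.

(* 'rV[T]_n carries the product sigma-algebra, generated by the coordinates.   *)
Section measurable_rV.
Context {d} {T : sigmaRingType d}.
Variable n : nat.

Let coors : 'I_n -> 'rV[T]_n -> T := fun i x => x ord0 i.

Let rV_set0 : g_sigma_preimage coors set0.
Proof. exact: sigma_algebra0. Qed.

Let rV_setC A : g_sigma_preimage coors A -> g_sigma_preimage coors (~` A).
Proof. exact: sigma_algebraC. Qed.

Let rV_bigcup (F : _^nat) : (forall i, g_sigma_preimage coors (F i)) ->
  g_sigma_preimage coors (\bigcup_i (F i)).
Proof. exact: sigma_algebra_bigcup. Qed.

HB.instance Definition _ := @isMeasurable.Build (measure_rV_display d)
  'rV[T]_n (g_sigma_preimage coors) rV_set0 rV_setC rV_bigcup.

End measurable_rV.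

Lemma measurable_coord d (T : sigmaRingType d) n (i : 'I_n) :
  measurable_fun [set: 'rV[T]_n] (fun x : 'rV[T]_n => x ord0 i).
Proof.
move=> _ Y mY; rewrite setTI; apply: sub_sigma_algebra => /=.
rewrite -bigcup_seq/=; exists i => /=; first by rewrite mem_index_enum.
by exists Y => //; rewrite setTI.
Qed.

Lemma measurable_fun_rVP d1 d2 (T1 : measurableType d1)
    (T2 : measurableType d2) n (f : T1 -> 'rV[T2]_n) :
  measurable_fun [set: T1] f <->
  forall i, measurable_fun [set: T1] (fun x => f x ord0 i).
Proof.
apply: (@iff_trans _ (g_sigma_preimage
    (fun i => (fun x : 'rV[T2]_n => x ord0 i) \o f) `<=` measurable)).
  rewrite g_sigma_preimage_comp; split=> [mf A [/= C preC <-]|prefS].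
    exact: mf.
  by move=> _ A mA; apply: prefS; exists A.
split=> [fS i|mf].
- move=> _ A mA.
  apply: fS; apply: sub_sigma_algebra.
  rewrite -bigcup_seq/=; exists i => /=; first by rewrite mem_index_enum.
  by exists A.
- apply: smallest_sub; first exact: sigma_algebra_measurable.
  rewrite -bigcup_seq; apply: bigcup_sub => i Ii.
  by move=> A [B mB <-]; exact: mf.
Qed.

Section cons_rV.
Context {T : Type} {n : nat}.

Definition cons_rV (p : T * 'rV[T]_n) : 'rV[T]_n.+1 :=
  \row_i oapp (p.2 ord0) p.1 (unlift ord0 i).

Definition uncons_rV (x : 'rV[T]_n.+1) : T * 'rV[T]_n :=
  (x ord0 ord0, \row_i x ord0 (lift ord0 i)).

Lemma cons_rVK : cancel cons_rV uncons_rV.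
Proof.
case=> a v; rewrite /uncons_rV /cons_rV !mxE unlift_none/=; congr pair.
by apply/rowP => i; rewrite !mxE liftK.
Qed.

End cons_rV.

Lemma measurable_cons_rV d (T : measurableType d) n :
  measurable_fun [set: T * 'rV[T]_n] (@cons_rV T n).
Proof.
apply/measurable_fun_rVP => i; rewrite /cons_rV.
under eq_fun do rewrite mxE.
case: unliftP => [j|] _ /=; last exact: measurable_fst.
apply: (measurableT_comp (measurable_coord j)).
exact: measurable_snd.
Qed.

Lemma measurable_uncons_rV d (T : measurableType d) n :
  measurable_fun [set: 'rV[T]_n.+1] (@uncons_rV T n).
Proof.
apply: measurable_fun_pair; first exact: measurable_coord.
apply/measurable_fun_rVP => i.
under eq_fun do rewrite mxE.
exact: measurable_coord.
Qed.

Section lebesgue_rV.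
Context {R : realType}.
Local Open Scope ereal_scope.

Section step.
Variables (n : nat) (m : {sigma_finite_measure set 'rV[R]_n -> \bar R}).

Definition lebesgue_rV_step (A : set 'rV[R]_n.+1) : \bar R :=
  (@lebesgue_measure R \x m) (@cons_rV R n @^-1` A).

Let mpre (A : set 'rV[R]_n.+1) : measurable A ->
  measurable (@cons_rV R n @^-1` A).
Proof. by move=> mA; rewrite -[X in measurable X]setTI; exact: measurable_cons_rV. Qed.

Let step0 : lebesgue_rV_step set0 = 0.
Proof. by rewrite /lebesgue_rV_step preimage_set0 measure0. Qed.

Let step_ge0 A : 0 <= lebesgue_rV_step A.
Proof. exact: measure_ge0. Qed.

Let step_sigma_additive : semi_sigma_additive lebesgue_rV_step.
Proof.
move=> F mF tF mUF; rewrite /lebesgue_rV_step preimage_bigcup.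
apply: measure_semi_sigma_additive.
- by move=> k; exact: mpre.
- apply/trivIsetP => /= i j _ _ ij; rewrite -preimage_setI.
  by move/trivIsetP : tF => /(_ _ _ _ _ ij) ->//; rewrite preimage_set0.
- by rewrite -preimage_bigcup; exact: mpre.
Qed.

HB.instance Definition _ := isMeasure.Build _ _ _ lebesgue_rV_step
  step0 step_ge0 step_sigma_additive.

Let step_sigma_finite : sigma_finite setT lebesgue_rV_step.
Proof.
have /sigma_finiteP[F [TF ndF Foo]] := sigma_finiteT (@lebesgue_measure R).
have /sigma_finiteP[G [TG ndG Goo]] := sigma_finiteT m.
exists (fun k => @uncons_rV R n @^-1` (F k `*` G k)).
  rewrite -preimage_bigcup (_ : \bigcup_k _ = setT) ?preimage_setT//.
  rewrite -setXTT TF TG predeqE => -[x y]; split.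
    by move=> [k _ []/= ? ?]; split; exists k.
  move=> [/= [k _ Fx] [l _ Gy]]; exists (maxn k l) => //; split.
  - by move: x Fx; exact/subsetPset/ndF/leq_maxl.
  - by move: y Gy; exact/subsetPset/ndG/leq_maxr.
move=> k; have [mFk Fkoo] := Foo k; have [mGk Gkoo] := Goo k.
have mFG : measurable (F k `*` G k) by exact: measurableX.
split.
  by rewrite -[X in measurable X]setTI; exact: measurable_uncons_rV.
rewrite /lebesgue_rV_step -comp_preimage (_ : _ \o _ = id); last first.
  by apply/funext => p /=; rewrite cons_rVK.
rewrite preimage_id product_measure1E// lte_mul_pinfty//.
by rewrite ge0_fin_numE.
Qed.

HB.instance Definition _ := Measure_isSigmaFinite.Build _ _ _ lebesgue_rV_step
  step_sigma_finite.

End step.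

Fixpoint lebesgue_rV (n : nat) : {sigma_finite_measure set 'rV[R]_n -> \bar R} :=
  if n is k.+1 then lebesgue_rV_step (lebesgue_rV k)
  else dirac (0%R : 'rV[R]_0).

End lebesgue_rV.

Section sphere.
Context {R : realType}.

(* The norm of the library on 'rV[R]_n is the sup norm. *)
Definition enorm (n : nat) (x : 'rV[R]_n) : R :=
  Num.sqrt (\sum_(i < n) x ord0 i ^+ 2).

Definition sphere (d : nat) : set 'rV[R]_d.+1 := [set x | enorm x = 1].
Arguments sphere d : clear implicits.

Lemma measurable_enorm n : measurable_fun [set: 'rV[R]_n] (@enorm n).
Proof.
apply: (@measurableT_comp _ _ _ _ _ _ (@Num.sqrt R)).
  apply: continuous_measurable_fun; exact: sqrt_continuous.
apply: measurable_sum => i; apply: measurable_funX; exact: measurable_coord.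
Qed.

Definition cone (d : nat) (A : set 'rV[R]_d.+1) : set 'rV[R]_d.+1 :=
  [set x | 0 < enorm x <= 1 /\ A ((enorm x)^-1 *: x)].

Lemma measurable_cone d (A : set 'rV[R]_d.+1) :
  measurable A -> measurable (cone A).
Proof.
move=> mA.
have mS := @measurable_enorm d.+1.
have mball : measurable [set x : 'rV[R]_d.+1 | 0 < enorm x <= 1].
  rewrite (_ : [set _ | _] = @enorm d.+1 @^-1` `]0, 1]%classic).
    by rewrite -[X in measurable X]setTI; exact: mS.
  by apply/seteqP; split => x /=; rewrite in_itv.
have mN : measurable_fun [set: 'rV[R]_d.+1]
    (fun x : 'rV[R]_d.+1 => (enorm x)^-1 *: x).
  apply/measurable_fun_rVP => i.
  rewrite (_ : (fun _ => _) = (fun x => enorm x `^ (-1) * x ord0 i)).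
    apply: measurable_funM; last exact: measurable_coord.
    exact: (@measurableT_comp _ _ _ _ _ _ (@powR R ^~ (-1))).
  by apply/funext => x; rewrite mxE powR_inv1// sqrtr_ge0.
rewrite (_ : cone A = [set x : 'rV[R]_d.+1 | 0 < enorm x <= 1] `&`
    (fun x : 'rV[R]_d.+1 => (enorm x)^-1 *: x) @^-1` A) //.
apply: measurableI => //.
by rewrite -[X in measurable X]setTI; exact: mN.
Qed.

(* Surface measure, by polar coordinates: omega(A) = (d+1) * vol(cone A). It   *)
(* is a measure on R^(d+1) that only sees the part of A lying on the sphere.   *)
Definition surface_measure (d : nat) (A : set 'rV[R]_d.+1) : \bar R :=
  (d.+1%:R%:E * lebesgue_rV d.+1 (cone A))%E.
Arguments surface_measure d A : clear implicits.

Section surface_measure.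
Local Open Scope ereal_scope.
Variable d : nat.
Local Notation omega := (surface_measure d).

Let omega0 : omega set0 = 0.
Proof.
rewrite /surface_measure (_ : cone set0 = set0) ?measure0 ?mule0//.
by apply/seteqP; split => x // [].
Qed.

Let omega_ge0 A : 0 <= omega A.
Proof. by rewrite mule_ge0// ?lee_fin ?ler0n. Qed.

Let omega_sigma_additive : semi_sigma_additive omega.
Proof.
move=> F mF tF mUF; rewrite /surface_measure.
have coneU : cone (\bigcup_k F k) = \bigcup_k cone (F k).
  by apply/seteqP; split => [x [xB [k _ Fkx]]|x [k _ [xB Fkx]]];
    [exists k|split => //; exists k].
rewrite coneU; under eq_fun do rewrite -ge0_sume_distrr//.
apply: cvgeZl => //; apply: measure_semi_sigma_additive.
- by move=> k; exact: measurable_cone.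
- apply/trivIsetP => i j _ _ ij.
  move/trivIsetP : tF => /(_ _ _ I I ij) Fij.
  apply/seteqP; split => // x [[_ Fi] [_ Fj]].
  have : (F i `&` F j) ((enorm x)^-1 *: x) by split.
  by rewrite Fij.
- by rewrite -coneU; exact: measurable_cone.
Qed.

HB.instance Definition _ := isMeasure.Build _ _ _ omega
  omega0 omega_ge0 omega_sigma_additive.

End surface_measure.

Definition sphere_area (d : nat) : R := fine (surface_measure d (sphere d)).

End sphere.

Arguments sphere {R} d.
Arguments surface_measure {R} d A.
Arguments sphere_area {R} d.

(* The dimension of the spherical harmonics of degree l on S^d, with the Gamma *)
(* functions at positive integers written as factorials; see dim_harmE for the *)
(* exactness of the division.                                                  *)
Definition dim_harm (d l : nat) : nat :=
  if l is 0 then 1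
  else (((2 * l + d - 1) * (l + d - 2)`!) %/ ((d - 1)`! * l`!))%N.

Lemma dim_harmE d l : (1 < d)%N -> (0 < l)%N ->
  (dim_harm d l * ((d - 1)`! * l`!) = (2 * l + d - 1) * (l + d - 2)`!)%N.
Proof.
case: d l => [|[|d]] [|l] // _ _; rewrite /dim_harm divnK//.
have -> : (2 * l.+1 + d.+2 - 1 = l.+1 + (l + d).+2)%N by lia.
have -> : (l.+1 + d.+2 - 2 = (l + d).+1)%N by lia.
rewrite subn1 /= mulnDl dvdn_add//.
- have := @bin_fact (l + d).+1 d.+1 ltac:(lia).
  rewrite (_ : (l + d).+1 - d.+1 = l)%N; last by lia.
  move=> <-; rewrite (factS l).
  apply/dvdnP; exists 'C((l + d).+1, d.+1).
  by rewrite mulnCA (mulnCA l.+1).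
- have := @bin_fact (l + d).+2 d.+1 ltac:(lia).
  rewrite (_ : (l + d).+2 - d.+1 = l.+1)%N; last by lia.
  by rewrite (factS (l + d).+1) => <-; exact: dvdn_mull.
Qed.

Section harmonics.
Context {R : realType}.
Variable d : nat.
Local Notation point := 'rV[R]_d.+1.
Local Notation "\int f" := (\int[surface_measure d]_(x in sphere d) f x)
  (at level 36).

Definition poly_eval (p : mpoly.mpoly d.+1 R) (x : point) : R :=
  mpoly.meval (fun i => x ord0 i) p.

Definition laplacian (p : mpoly.mpoly d.+1 R) : mpoly.mpoly d.+1 R :=
  \sum_(i < d.+1) mpoly.mderiv i (mpoly.mderiv i p).

(* Functions on S^d are represented by functions on R^(d+1), of which only the *)
(* values on the sphere matter.                                                *)

(* The class P_n(S^d); mmeasure mdeg p is the total degree of p plus one.     *)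
Definition sphere_poly (n : nat) (f : point -> R) : Prop :=
  exists2 p : mpoly.mpoly d.+1 R,
    (mpoly.mmeasure mpoly.mdeg p <= n.+1)%N &
    forall x, sphere d x -> f x = poly_eval p x.

Definition spherical_harmonic (l : nat) (f : point -> R) : Prop :=
  exists p : mpoly.mpoly d.+1 R,
    [/\ p \is mpoly.ishomog1 l mpoly.mdeg, laplacian p = 0 &
        forall x, sphere d x -> f x = poly_eval p x].

Definition harmonic_basis (Y : forall l, 'I_(dim_harm d l) -> point -> R) :=
  forall l, [/\ forall k, spherical_harmonic l (Y l k),
    forall k k', \int (Y l k \* Y l k') = (k == k')%:R &
    forall f, spherical_harmonic l f ->
      exists c : 'I_(dim_harm d l) -> R,
        forall x, sphere d x -> f x = \sum_k c k * Y l k x].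

Section sobolev.
Variables (a : nat -> R) (Y : forall l, 'I_(dim_harm d l) -> point -> R).

Definition fourier_coef (f : point -> R) (l : nat) (k : 'I_(dim_harm d l)) : R :=
  \int (f \* Y k).

Definition sobolev_sqnorm (f : point -> R) : \bar R :=
  (\sum_(0 <= l <oo)
     (\sum_(k < dim_harm d l) (a l)^-1 * `|fourier_coef f k| ^+ 2)%:E)%E.

Definition sobolev_norm (f : point -> R) : R :=
  Num.sqrt (fine (sobolev_sqnorm f)).

Definition L2_sphere (f : point -> R) : Prop :=
  measurable_fun (sphere d) f /\
  (\int[surface_measure d]_(x in sphere d) (`|f x| ^+ 2)%:E < +oo)%E.

(* The elements are the continuous representatives.                            *)
Definition sobolev (f : point -> R) : Prop :=
  [/\ {within sphere d, continuous f}, L2_sphere f &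
      (sobolev_sqnorm f < +oo)%E].

End sobolev.

Definition quadrature_error (m : nat) (x : 'I_m -> point) (f : point -> R) : R :=
  `|sphere_area d / m%:R * \sum_(j < m) f (x j) - \int f|.

(* M is the index set of the sequence, c the QMC constant.                     *)
Definition QMC_designs (s : R) (a : nat -> R)
    (Y : forall l, 'I_(dim_harm d l) -> point -> R)
    (M : set nat) (X : forall m, 'I_m -> point) (c : R) : Prop :=
  [/\ infinite_set M /\ (forall m, M m -> (0 < m)%N),
      forall m, M m -> forall j, sphere d (X m j),
      0 < c &
      forall m, M m -> forall f, sobolev a Y f ->
        quadrature_error (X m) f <=
          c / m%:R `^ (s / d%:R) * sobolev_norm a Y f].

End harmonics.

Definition comparable_weights {R : realType} (s : R) (a : nat -> R) : Prop :=
  exists c1 c2 : R, [/\ 0 < c1, 0 < c2 &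
    forall l, c1 * (1 + l%:R) `^ (- (2 * s)) <= a l
              <= c2 * (1 + l%:R) `^ (- (2 * s))].

(* Main.v *)
From HB Require Import structures.
Require Import Defs.
From mathcomp Require Import all_boot all_order all_algebra.
From mathcomp Require Import ring lra zify.
From mathcomp.multinomials Require mpoly.

Set Implicit Arguments.
Unset Strict Implicit.
Unset Printing Implicit Defensive.

Import Order.TTheory GRing.Theory Num.Theory.
Import (canonicals, coercions) mpoly.

Local Open Scope ring_scope.

(** Apply the QMC bound to [chi ^+ 2], which is a polynomial of degree at most 2n on the sphere.
    Only degrees l <= 2n occur in its expansion, where 1/a_l is at most (2n+1)^(2s) / c1; with
    Bessel's inequality ([harmonic_bessel]) its H^s norm is at most c1^(-1/2) (2n+1)^s times the L^2
    norm of chi^2. What remains is to bound the integral of chi^4 by the square of the integral of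
    chi^2.

    This is [quartic_mpoly]. Let e_1, ..., e_r be an orthonormal basis of the polynomials of degree
    at most n on the sphere, and K the sum of the e_i^2. By Cauchy-Schwarz, chi^2 is at most K times
    the integral of chi^2; multiplying by chi^2 and integrating bounds the integral of chi^4 by that
    of chi^2 times that of K chi^2. Rotation invariance makes K constant, equal to r / |S^d|, so the
    integral of chi^4 is at most r / |S^d| times the squared integral of chi^2. Counting monomials,
    r <= (n+1)^(d+1), and [dim_harm_mul_ge] bounds this by (d-1)! d! Z(d,n) Z(d+1,n).

    Rotations enter only infinitesimally. Integration over the sphere is a linear functional T on
    polynomials with T(|x|^2 g) = T(g) that kills every x_i d_j g - x_j d_i g. These two rules
    determine T up to a factor ([rot_invariant_unique]), make harmonics of different degrees
    orthogonal ([harmonic_orthogonal]), and yield the constancy of K in the weak form T(1) T(K g) =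
    T(K) T(g). That the surface integral obeys them ([sphere_functional_rot]) follows from the
    divergence theorem on the ball, obtained by slicing ([integral_partial]) and carried to the
    sphere through polynomial approximations of 1/|x| ([integral_rotd_normalize]). *)

(** * Infinitesimal rotations of polynomials *)

Section Rotation.
Import mpoly.
Variables (R : rcfType) (N : nat).
Implicit Types p q g h : {mpoly R[N]}.

Definition sumsq : {mpoly R[N]} := \sum_(i < N) 'X_i ^+ 2.

(** The generator of rotations in the (i, j) coordinate plane, a vector field tangent to every
    sphere centred at the origin. *)
Definition rotd (i j : 'I_N) g : {mpoly R[N]} := 'X_i * g^`M(j) - 'X_j * g^`M(i).

Lemma mderivXU i j : ('X_j : {mpoly R[N]})^`M(i) = (i == j)%:R.
Proof.
rewrite mderivX mnm1E eq_sym; case: eqP => [->|_]; last by rewrite scale0r.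
have -> : (U_(j) - U_(j) = 0)%MM by apply/mnmP => k; rewrite mnmBE mnm0E subnn.
by rewrite mpolyX0 scale1r.
Qed.

Lemma mnm_addU (m : 'X_{1..N}) (i : 'I_N) : (0 < m i)%N -> (m = U_(i) + (m - U_(i)))%MM.
Proof.
move=> mi; apply/mnmP => j; rewrite mnmDE mnmBE mnm1E.
by case: eqP => [<-|_] //=; rewrite ?add0n ?subn0 // subnKC.
Qed.

Lemma mnm_case (m : 'X_{1..N}) : (m = 0%MM :> 'X_{1..N}) \/ exists i m', m = (U_(i) + m')%MM.
Proof.
have [->|] := eqVneq m 0%MM; first by left.
rewrite -mdeg_eq0 mdegE sum_nat_eq0 negb_forall => /existsP[i]; rewrite implyTb.
by rewrite -lt0n => /mnm_addU mE; right; exists i, (m - U_(i))%MM.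
Qed.

Lemma mpoly_ring_ind (P : {mpoly R[N]} -> Prop) :
  (forall c, P c%:MP) -> (forall i, P 'X_i) ->
  (forall p q, P p -> P q -> P (p + q)) -> (forall p q, P p -> P q -> P (p * q)) ->
  forall p, P p.
Proof.
move=> PC PX PD PM; elim/mpolyind => [|c m p _ _ Pp]; first by rewrite -mpolyC0.
apply: (PD) => //; rewrite -mul_mpolyC; apply: (PM) => //.
have [k] := ubnP (mdeg m); elim: k m => // k IH m.
have [->|[i [m' ->]]] := mnm_case m; first by rewrite mpolyX0 -mpolyC1.
by rewrite mdegD mdeg1 add1n ltnS mpolyXD => /IH; exact: PM.
Qed.

Lemma euler l p : p \is l.-homog -> \sum_i 'X_i * p^`M(i) = l%:R *: p.
Proof.
move=> hp; rewrite {2}[p]mpolyE scaler_sumr.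
under eq_bigr => i _ do rewrite {1}[p]mpolyE raddf_sum mulr_sumr.
rewrite exchange_big /=; apply: eq_big_seq => m mp.
under eq_bigr => i _.
  rewrite mderivZ mderivX scalerA -scalerAr -mpolyXD.
  rewrite (_ : _ *: _ = (p@_m * (m i)%:R) *: 'X_[m]); last first.
    case: (posnP (m i)) => [->|mi]; first by rewrite mulr0 !scale0r.
    by rewrite -mnm_addU.
  over.
rewrite -scaler_suml -mulr_sumr -natr_sum -mdegE (dhomog_mf hp mp) scalerA.
by rewrite mulrC.
Qed.

Lemma dhomog_mderiv l p i : p \is l.+1.-homog -> p^`M(i) \is l.-homog.
Proof.
move=> hp; rewrite [p]mpolyE raddf_sum /= big_seq; apply: rpred_sum => m mp.
rewrite mderivZ mderivX; apply: dhomogZ.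
case: (posnP (m i)) => [->|mi]; first by rewrite scale0r dhomog0.
apply: dhomogZ; rewrite dhomogX; apply/eqP/succn_inj.
have <- := dhomog_mf hp mp; rewrite [in RHS](mnm_addU mi) /= mdegD mdeg1.
by rewrite add1n.
Qed.

Lemma rotdM i j p q : rotd i j (p * q) = rotd i j p * q + p * rotd i j q.
Proof. by rewrite /rotd !mderivM; ring. Qed.

Lemma rotdD i j p q : rotd i j (p + q) = rotd i j p + rotd i j q.
Proof. by rewrite /rotd !mderivD; ring. Qed.

Lemma rotdZ i j c p : rotd i j (c *: p) = c *: rotd i j p.
Proof. by rewrite /rotd !mderivZ -!mul_mpolyC; ring. Qed.

Lemma rotd1 i j : rotd i j 1 = 0.
Proof. by rewrite /rotd -mpolyC1 !mderivC !mulr0 subrr. Qed.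

Lemma rotdX i j p k : rotd i j p = 0 -> rotd i j (p ^+ k) = 0.
Proof.
move=> p0; elim: k => [|k IH]; first by rewrite expr0 rotd1.
by rewrite exprS rotdM p0 IH mul0r mulr0 addr0.
Qed.

Lemma dhomog_rotd l i j p : p \is l.-homog -> rotd i j p \is l.-homog.
Proof.
move=> hp; suff H a b : 'X_a * p^`M(b) \is l.-homog by rewrite rpredB.
case: l hp => [|l] hp; last first.
  rewrite -[l.+1]add1n; apply: dhomogM; last exact: dhomog_mderiv.
  by rewrite dhomogX; apply/eqP; exact: mdeg1.
rewrite (_ : p^`M(b) = 0) ?mulr0 ?dhomog0 //.
rewrite [p]mpolyE raddf_sum /= big_seq big1 // => m mp.
have /eqP := dhomog_mf hp mp; rewrite /= mdeg_eq0 => /eqP ->.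
by rewrite mpolyX0 mderivZ -mpolyC1 mderivC scaler0.
Qed.

Lemma meval_dhomog l p (v : 'I_N -> R) c : p \is l.-homog ->
  p.@[fun i => c * v i] = c ^+ l * p.@[v].
Proof.
move=> hp; rewrite !mevalE mulr_sumr; apply: eq_big_seq => m mp.
under eq_bigr do rewrite exprMn.
by rewrite big_split /= prodrXr -mdegE (dhomog_mf hp mp) mulrCA.
Qed.

Lemma mderiv_sumsq i : sumsq^`M(i) = 2%:R * 'X_i.
Proof.
rewrite raddf_sum (bigD1 i) //= big1 => [|j /negPf ji].
  by rewrite expr2 mderivM mderivXU eqxx mulr1n; ring.
by rewrite expr2 mderivM mderivXU eq_sym ji mulr0n; ring.
Qed.

Lemma rotd_sumsq i j : rotd i j sumsq = 0.
Proof. by rewrite /rotd !mderiv_sumsq; ring. Qed.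

Lemma rotdXM i j g : rotd i j ('X_j * g) =
  'X_i * g + 'X_i * ('X_j * g^`M(j)) - (i == j)%:R * ('X_j * g) - 'X_j ^+ 2 * g^`M(i).
Proof.
by rewrite /rotd !mderivM !mderivXU eqxx mulr1n; set b := (i == j)%:R; ring.
Qed.

(** By Euler's identity, the sum of X_i d_j (X_j g) over j is (N + m) X_i g, while that of X_j d_i
    (X_j g) is X_i g + |x|^2 d_i g. A functional that kills rotations thereby trades multiplication
    by X_i for d_i. *)
Lemma sum_rotd m g i : g \is m.-homog ->
  \sum_j rotd i j ('X_j * g) = (N%:R - 1 + m%:R) *: ('X_i * g) - sumsq * g^`M(i).
Proof.
move=> hg; under eq_bigr => j _ do rewrite rotdXM.
rewrite !sumrB big_split /= -!mulr_sumr -mulr_suml (euler hg) sumr_const card_ord.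
congr (_ - _); rewrite (bigD1 i) //= eqxx mulr1n big1 => [|j /negPf ji]; last first.
  by rewrite eq_sym ji mul0r.
by rewrite -!mul_mpolyC !rmorphD rmorphN rmorph1 /= -mulr_natl !mpolyC_nat; ring.
Qed.

(* Newton's iteration for the inverse square root of [sumsq]. *)
Fixpoint newton k : {mpoly R[N]} :=
  if k is l.+1 then 2^-1 *: (newton l * (3%:R%:MP - sumsq * newton l ^+ 2)) else 1.

(** The iterates are polynomials in |x|^2, hence radial, and rotations kill radial functions. *)
Lemma rotd_newton i j k : rotd i j (newton k) = 0.
Proof.
elim: k => [|k IH] /=; first exact: rotd1.
rewrite rotdZ rotdM IH -scaleN1r rotdD rotdZ rotdM rotd_sumsq rotdX //.
by rewrite /rotd !mderivC !(mulr0, mul0r, addr0, subr0, scaler0).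
Qed.

End Rotation.
Arguments sumsq {R N}.
Arguments rotd {R N} i j g.
Arguments newton {R N} k.

(** * Rotation-invariant functionals and harmonic polynomials *)

Section Functional.
Import mpoly.
Variables (R : rcfType) (N : nat).
Hypothesis N_gt1 : (1 < N)%N.
Implicit Types (p q g h : {mpoly R[N]}) (T : {scalar {mpoly R[N]}}).

(** The first condition allows |x|^2 to be replaced by 1, as for a functional that sees only the
    unit sphere; the second is invariance under the Lie algebra of rotations. *)
Definition rot_invariant T :=
  (forall g, T (sumsq * g) = T g) /\ (forall i j g, T (rotd i j g) = 0).

Lemma coef_gt0 m : 0 < N%:R - 1 + m%:R :> R.
Proof.
have : 2 <= N%:R :> R by rewrite ler_nat.
have : 0 <= m%:R :> R by []. lra.
Qed.

Lemma functional_mulX T m g i : rot_invariant T -> g \is m.-homog ->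
  (N%:R - 1 + m%:R) * T ('X_i * g) = T g^`M(i).
Proof.
move=> [hS hR] hg; have /(congr1 T) := sum_rotd i hg.
rewrite raddf_sum big1 //= linearB linearZ /= hS => /esym/eqP.
by rewrite subr_eq0 => /eqP.
Qed.

Lemma functional_ext T p :
  (forall m, m \in msupp p -> T 'X_[m] = 0) -> T p = 0.
Proof.
move=> h; rewrite [p]mpolyE raddf_sum /= big_seq big1 // => m mp.
by rewrite linearZ /= h // mulr0.
Qed.

(** [functional_mulX] computes T on a monomial from its value in lower degree, with a recursion that
    is the same for every invariant T; so T is fixed by its value at 1. *)
Lemma rot_invariant_unique T1 T2 g : rot_invariant T1 -> rot_invariant T2 ->
  T1 1 * T2 g = T2 1 * T1 g.
Proof.
move=> h1 h2; suff H m : T1 1 * T2 'X_[m] = T2 1 * T1 'X_[m].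
  rewrite [g]mpolyE !raddf_sum /= !mulr_sumr; apply: eq_bigr => m _.
  by rewrite !linearZ /= mulrCA H mulrCA.
have [n] := ubnP (mdeg m); elim: n m => // n IH m.
have [->|[i [m' ->]]] := mnm_case m; first by rewrite mpolyX0 mulrC.
rewrite mdegD mdeg1 add1n ltnS => mn; rewrite mpolyXD.
have hm : 'X_[m'] \is [in R[N], (mdeg m').-homog] by rewrite dhomogX.
have c0 := coef_gt0 (mdeg m'); apply: (mulfI (lt0r_neq0 c0)).
rewrite mulrCA [RHS]mulrCA !(functional_mulX _ _ hm) // mderivX !linearZ /=.
by rewrite mulrCA [RHS]mulrCA IH // (leq_ltn_trans _ mn) // mdegB.
Qed.

(** Up to nonzero factors, Euler's identity writes T(p) as the sum of the T(X_i d_i p), and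
    [functional_mulX] turns that sum into T of the Laplacian of p. *)
Lemma functional_harmonic T l p : rot_invariant T -> p \is l.+1.-homog ->
  \sum_i p^`M(i)^`M(i) = 0 -> T p = 0.
Proof.
move=> hT hp lp; have /(congr1 T) := euler hp; rewrite linearZ raddf_sum /=.
rewrite (_ : \sum_i _ = 0); last first.
  have c0 := coef_gt0 l; apply: (mulfI (lt0r_neq0 c0)).
  rewrite mulr0 mulr_sumr; under eq_bigr => i _.
    rewrite (functional_mulX _ hT (dhomog_mderiv i hp)); over.
  by rewrite -raddf_sum lp raddf0.
by move/esym/eqP; rewrite mulf_eq0 pnatr_eq0 => /eqP.
Qed.

Lemma weighted_is_scalar T p : scalar (fun q => T (q * p)).
Proof. by move=> c u v; rewrite mulrDl -scalerAl linearP. Qed.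

(** The functional T with density p, packed as a linear form so that the results on linear and on
    invariant functionals apply to it. *)
Definition weighted T p : {scalar {mpoly R[N]}} :=
  HB.pack (fun q => T (q * p))
    (GRing.isLinear.Build R {mpoly R[N]} R _ _ (weighted_is_scalar T p)).

(** Induction on the degree of a monomial of q. Splitting off a variable X_i and applying
    [functional_mulX] and the product rule leaves two terms: one differentiates the monomial, the
    other replaces p by d_i p, which is again harmonic and of degree l - 1. As the monomial has
    degree below l, it is used up first, and [functional_harmonic] ends the descent. *)
Lemma harmonic_orthogonal T l p q : rot_invariant T -> p \is l.-homog ->
  \sum_i p^`M(i)^`M(i) = 0 -> (msize q <= l)%N -> T (p * q) = 0.
Proof.
move=> hT hp lp ql; rewrite mulrC.
change (weighted T p q = 0).
apply: functional_ext => m /msize_mdeg_lt /leq_trans /(_ ql) {ql q}.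
change ((mdeg m < l)%N -> T ('X_[m] * p) = 0).
have [n] := ubnP (mdeg m); elim: n m l p hp lp => // n IH m l p hp lp.
have [->|[i [m' ->]]] := mnm_case m.
  rewrite mdeg0 mpolyX0 mul1r => _; case: l hp => // l hp _.
  exact: functional_harmonic hp lp.
rewrite mdegD mdeg1 add1n ltnS => mn ml; rewrite mpolyXD -mulrA.
case: l hp ml => // l hp; rewrite ltnS => ml.
have hm : 'X_[m'] * p \is [in R[N], (mdeg m' + l.+1).-homog].
  by apply: dhomogM => //; rewrite dhomogX.
have c0 := coef_gt0 (mdeg m' + l.+1); apply: (mulfI (lt0r_neq0 c0)).
rewrite mulr0 (functional_mulX _ hT hm) mderivM linearD /= mderivX -scalerAl linearZ /=.
have mB := mdegB m' U_(i).
have lpi : \sum_j p^`M(i)^`M(j)^`M(j) = 0.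
  under eq_bigr => j _ do rewrite (mderiv_comm i j p) (mderiv_comm i j (p^`M(j))).
  by rewrite -raddf_sum lp raddf0.
rewrite (IH _ _ _ hp lp (leq_ltn_trans mB mn) (leq_ltn_trans mB (leqW ml))) mulr0 add0r.
exact: (IH _ _ _ (dhomog_mderiv i hp) lpi mn ml).
Qed.

End Functional.

(** * Positive semidefinite forms: Gram-Schmidt, Bessel and the reproducing kernel *)

Section Positivity.
Variables (R : rcfType) (A : comAlgType R) (T : {scalar A}).
Implicit Types p q g h : A.

Lemma scalarMl c p q : T ((c *: p) * q) = c * T (p * q).
Proof. by rewrite -scalerAl linearZ. Qed.

Lemma scalarMr c p q : T (p * (c *: q)) = c * T (p * q).
Proof. by rewrite -scalerAr linearZ. Qed.

Hypothesis T_ge0 : forall p, 0 <= T (p * p).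

(** The degenerate case of Cauchy-Schwarz. The form is only semidefinite: on polynomials, all
    multiples of 1 - |x|^2 are null for the sphere, so identities below hold modulo null vectors. *)
Lemma null_mul p q : T (p * p) = 0 -> T (p * q) = 0.
Proof.
move=> p0; apply/eqP; apply/negP => /negP pq0.
(* Chosen so that T((t p + q)^2) = 2 t T(p q) + T(q^2) equals -1, against positivity. *)
pose t := - (T (q * q) + 1) / (2 * T (p * q)).
have := T_ge0 (t *: p + q).
rewrite mulrDl !mulrDr !linearD /= !scalarMl !scalarMr p0 [q * p]mulrC /t.
rewrite leNgt => /negP; apply.
by rewrite (_ : _ + _ = -1) ?oppr_lt0 ?ltr01 //; field.
Qed.

Lemma nullD p q : T (p * p) = 0 -> T (q * q) = 0 -> T ((p + q) * (p + q)) = 0.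
Proof.
move=> p0 q0; rewrite mulrDl !mulrDr !linearD /= p0 q0 [q * p]mulrC.
by rewrite (null_mul q p0) !addr0.
Qed.

Lemma nullZ c p : T (p * p) = 0 -> T ((c *: p) * (c *: p)) = 0.
Proof. by move=> p0; rewrite scalarMl scalarMr p0 !mulr0. Qed.

Definition proj (r : nat) (e : 'I_r -> A) g := \sum_i T (g * e i) *: e i.

Lemma proj_linear r (e : 'I_r -> A) : linear (proj e).
Proof.
move=> c p q; rewrite /proj scaler_sumr -big_split /=; apply: eq_bigr => i _.
by rewrite mulrDl linearD /= scalarMl scalerDl scalerA.
Qed.

Definition orthonormal_family (I : finType) (e : I -> A) :=
  forall i j, T (e i * e j) = (i == j)%:R.

Lemma orthonormal_coef (I : finType) (e : I -> A) c j :
  orthonormal_family e -> T ((\sum_i c i *: e i) * e j) = c j.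
Proof.
move=> oe; rewrite mulr_suml raddf_sum (bigD1 j) //= big1 ?addr0 => [|i /negPf ij].
  by rewrite scalarMl oe eqxx mulr1.
by rewrite scalarMl oe ij mulr0.
Qed.

Lemma bessel (I : finType) (e : I -> A) g : orthonormal_family e ->
  \sum_i T (g * e i) ^+ 2 <= T (g * g).
Proof.
move=> oe; pose h := \sum_i T (g * e i) *: e i.
have gh : T (g * h) = \sum_i T (g * e i) ^+ 2.
  rewrite mulr_sumr raddf_sum; apply: eq_bigr => i _ /=.
  by rewrite scalarMr.
have hh : T (h * h) = \sum_i T (g * e i) ^+ 2.
  rewrite {2}/h mulr_sumr raddf_sum; apply: eq_bigr => i _ /=.
  by rewrite scalarMr orthonormal_coef.
have := T_ge0 (g - h).
rewrite (_ : (g - h) * (g - h) = g * g - g * h - g * h + h * h); last by ring.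
by rewrite linearD !linearB /= gh hh -addrA addNr addr0 subr_ge0.
Qed.

(** Spanning is expressed by null remainders, because distinct polynomials may agree on the sphere.
    The predicate [V] keeps the new vectors inside the given space, which later has to be stable
    under rotations. *)
Lemma gram_schmidt (V : A -> Prop) gs :
  (forall c p q, V p -> V q -> V (c *: p + q)) -> V 0 ->
  (forall g, g \in gs -> V g) ->
  exists r, (r <= size gs)%N /\ exists e : 'I_r -> A,
    [/\ forall i, V (e i), orthonormal_family e &
     forall g, g \in gs -> T ((g - proj e g) * (g - proj e g)) = 0].
Proof.
move=> VD V0; elim: gs => [|g0 gs IH] Vgs.
  by exists 0%N; split=> //; exists (fun _ => 0); split=> // [] [].
have [|r [rs [e [Ve oe he]]]] := IH; first by move=> g gg; apply: Vgs; rewrite inE gg orbT.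
pose h := g0 - proj e g0.
have Vh : V h.
  rewrite /h addrC -scaleN1r; apply: (VD); last by apply: Vgs; rewrite mem_head.
  by apply: (big_ind V) => // [p q Vp Vq|i _]; [rewrite -[p]scale1r|rewrite -[_ *: _]addr0]; exact: VD.
have he0 i : T (h * e i) = 0.
  by rewrite mulrBl linearB /= orthonormal_coef // subrr.
(* A null remainder means that [g0] adds nothing to the span; otherwise the remainder is normalized
   and joined to the family. *)
have [h0|hn0] := eqVneq (T (h * h)) 0.
  exists r; split; first exact: leqW.
  exists e; split=> // g; rewrite inE => /orP[/eqP->|] //; exact: he.
have h_gt0 : 0 < T (h * h) by rewrite lt_neqAle eq_sym hn0 T_ge0.
pose t := Num.sqrt (T (h * h)).
have t0 : t != 0 by rewrite lt0r_neq0 // sqrtr_gt0.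
have tt : T (h * h) = t * t by rewrite -[t * t]expr2 sqr_sqrtr // ltW.
exists r.+1; split=> //.
pose e' (i : 'I_r.+1) := oapp e (t^-1 *: h) (unlift ord0 i).
have e'0 : e' ord0 = t^-1 *: h by rewrite /e' unlift_none.
have e'S i : e' (lift ord0 i) = e i by rewrite /e' liftK.
have projE g : proj e' g = (T (g * h) / (t * t)) *: h + proj e g.
  rewrite /proj big_ord_recl e'0 scalarMr scalerA; congr (_ *: _ + _).
    by field.
  by apply: eq_bigr => i _; rewrite e'S.
exists e'; split.
- move=> i; case: (unliftP ord0 i) => [j|] ->; rewrite ?e'S // e'0 -[_ *: _]addr0.
  exact: VD.
- move=> i j; case: (unliftP ord0 i) => [i'|] ->; case: (unliftP ord0 j) => [j'|] ->.
  + by rewrite !e'S oe (inj_eq lift_inj).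
  + by rewrite e'S e'0 scalarMr [e _ * h]mulrC he0 mulr0.
  + by rewrite e'S e'0 scalarMl he0 mulr0.
  + by rewrite e'0 scalarMl scalarMr tt eqxx mulr1n; field.
- have hg g : T (g * h) = T ((g - proj e g) * h).
    rewrite mulrBl linearB /= mulr_suml raddf_sum big1 ?subr0 // => i _ /=.
    by rewrite scalarMl mulrC [e i * h]mulrC he0 mul0r.
  move=> g; rewrite inE projE => /orP[/eqP->|gg].
    rewrite hg -/h tt divff ?mulf_neq0 // scale1r.
    by rewrite (_ : g0 - _ = 0) ?mul0r ?linear0 // /h subrK subrr.
  by rewrite hg (null_mul h (he g gg)) mul0r scale0r add0r he.
Qed.


Section Kernel.
Variables (r : nat) (e : 'I_r -> A).
(** The diagonal K(x, x) of the reproducing kernel of the span of [e]. *)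
Definition kernel := \sum_i e i * e i.

(** Integrating by parts, the matrix a_ij = T(D(e_i) e_j) is antisymmetric. Modulo null vectors,
    D(e_i) is the sum of the a_ij e_j, so D of the kernel is twice the sum of the a_ij e_i e_j,
    which cancels under exchange of i and j. *)
Lemma kernel_derivation (D : A -> A) g :
  (forall p q, D (p * q) = D p * q + p * D q) -> (forall p q, D (p + q) = D p + D q) ->
  (forall p, T (D p) = 0) ->
  (forall i, T ((D (e i) - proj e (D (e i))) * (D (e i) - proj e (D (e i)))) = 0) ->
  T (D kernel * g) = 0.
Proof.
move=> DM DD TD De; pose a i j := T (D (e i) * e j).
have a_anti i j : a i j = - a j i.
  apply/eqP; rewrite -addr_eq0 /a [D (e j) * _]mulrC -linearD /=.
  by rewrite -DM TD.
have D0 : D 0 = 0 by apply: (addrI (D 0)); rewrite -DD !addr0.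
have -> : D kernel = 2 *: \sum_i e i * D (e i).
  rewrite /kernel (big_morph D DD D0) scaler_sumr; apply: eq_bigr => i _.
  by rewrite DM mulrC -[2]/(1 + 1) scalerDl scale1r.
rewrite scalarMl mulr_suml linear_sum /=.
suff -> : \sum_i T (e i * D (e i) * g) = \sum_i \sum_j a i j * T (e i * e j * g).
  set Z := \sum_i _; have : Z = - Z.
    rewrite {1}/Z exchange_big -sumrN; apply: eq_bigr => i _.
    rewrite -sumrN; apply: eq_bigr => j _.
    by rewrite a_anti mulNr [e j * _]mulrC.
  by lra.
apply: eq_bigr => i _.
have De0 := null_mul (e i * g) (De i).
rewrite -[D (e i)](subrK (proj e (D (e i)))) mulrDr mulrDl linearD /=.
rewrite (_ : T (e i * (D (e i) - _) * g) = 0); last by rewrite -mulrA mulrCA.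
rewrite add0r /proj mulr_sumr mulr_suml linear_sum; apply: eq_bigr => j _ /=.
by rewrite -mulrA mulrCA scalarMl mulrCA mulrA.
Qed.

(** Cauchy-Schwarz gives f^2 <= T(f^2) K pointwise; here it is used after multiplication by f^2 and
    application of T. The last hypothesis says that K acts as a constant against f^2, and T(K) = r
    by orthonormality. *)
Lemma quartic_bound f : orthonormal_family e -> T ((f - proj e f) * (f - proj e f)) = 0 ->
  T 1 * T (kernel * (f * f)) = T kernel * T (f * f) ->
  T 1 * T (f * f * (f * f)) <= r%:R * T (f * f) ^+ 2.
Proof.
move=> oe fe fK; pose g := proj e f; pose c i := T (f * e i).
pose b i j := T (f * f * (e i * e j)).
(* The difference f^4 - f^2 g^2 has the null factor f - g, so two of the four factors may be
   expanded in the family. *)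
have ffgg : T (f * f * (f * f)) = \sum_i \sum_j c i * c j * b i j.
  have -> : f * f * (f * f) = (f - g) * (f * f * (f + g)) + f * f * (g * g) by ring.
  rewrite linearD /= null_mul // add0r /g /proj mulr_suml mulr_sumr linear_sum /=.
  apply: eq_bigr => i _; rewrite !mulr_sumr linear_sum /=; apply: eq_bigr => j _.
  by rewrite -scalerAl scalarMr -scalerAr scalarMr mulrA.
have ffc : T (f * f) = \sum_i c i ^+ 2.
  have /eqP : T ((f - g) * f) = 0 by exact: null_mul.
  rewrite mulrBl linearB subr_eq0 => /eqP -> /=; rewrite mulr_suml linear_sum /=.
  by apply: eq_bigr => i _; rewrite scalarMl mulrC [e i * f]mulrC expr2.
have Tk : T kernel = r%:R.
  rewrite linear_sum /= (eq_bigr (fun=> 1)) ?sumr_const ?card_ord // => i _.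
  by rewrite oe eqxx.
have kff : T (kernel * (f * f)) = \sum_i b i i.
  by rewrite mulr_suml linear_sum; apply: eq_bigr => i _; rewrite /b mulrC.
have lagrange : T (f * f * (f * f)) <= T (f * f) * T (kernel * (f * f)).
  (* Lagrange's identity: the summand is T of the square of f (c_i e_j - c_j e_i), and the double
     sum is twice the difference of the two sides. *)
  have : 0 <= \sum_i \sum_j (c i ^+ 2 * b j j + c j ^+ 2 * b i i - 2 * (c i * c j * b i j)).
    apply: sumr_ge0 => i _; apply: sumr_ge0 => j _.
    have := T_ge0 (f * (c i *: e j - c j *: e i)).
    have -> : f * (c i *: e j - c j *: e i) * (f * (c i *: e j - c j *: e i)) =
      (f * (c i *: e j - c j *: e i)) * (c i *: (f * e j) - c j *: (f * e i)).
      by rewrite mulrBr !scalerAr.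
    rewrite !mulrBr linearB /= !scalarMr !mulrBl !linearB /=.
    have E x y u : T (f * (u *: x) * (f * y)) = u * T (f * f * (x * y)).
      by rewrite -scalerAr scalarMl; congr (_ * T _); ring.
    rewrite !E -/(b j j) -/(b i i) -/(b i j) (_ : T (f * f * (e j * e i)) = b i j).
      by move=> /le_trans; apply; rewrite le_eqVlt; apply/orP; left; apply/eqP; ring.
    by rewrite /b [e j * _]mulrC.
  under eq_bigr => i _.
    rewrite sumrB big_split /= -mulr_sumr -mulr_suml -mulr_sumr; over.
  rewrite sumrB big_split /= -mulr_suml -!mulr_sumr -ffgg -ffc -kff.
  lra.
have T1 : 0 <= T 1 by rewrite -[1]mulr1.
apply: le_trans (ler_wpM2l T1 lagrange) _.
by rewrite mulrCA fK Tk expr2 mulrCA.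
Qed.

End Kernel.

End Positivity.

(** * The quartic inequality for polynomials of bounded degree *)

Section Quartic.
Import mpoly.
Variables (R : rcfType) (N : nat).
Hypothesis N_gt1 : (1 < N)%N.
Variable T : {scalar {mpoly R[N]}}.
Hypothesis T_ge0 : forall p, 0 <= T (p * p).
Hypothesis T_rot : rot_invariant T.

Lemma card_bmultinom n : (#|{: 'X_{1..N < n}}| <= n ^ N)%N.
Proof.
(* The default in [insubd] is never reached: each exponent is at most the total degree, hence below
   n. *)
pose f (m : 'X_{1..N < n}) : {ffun 'I_N -> 'I_n} :=
  [ffun i => insubd (Ordinal (leq_ltn_trans (leq0n _) (bmdeg m))) (m i)].
have fE m i : f m i = m i :> nat.
  rewrite ffunE val_insubd ifT //; apply: leq_ltn_trans (bmdeg m).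
  by rewrite mdegE (bigD1 i) //= leq_addr.
have /card_in_image : {in predT &, injective f}.
  move=> m1 m2 _ _ /ffunP H; apply: val_inj; apply/mnmP => i.
  by rewrite -!fE H.
move=> <-; rewrite -[X in (_ <= X ^ _)%N]card_ord -[X in (_ <= _ ^ X)%N]card_ord.
by rewrite -card_ffun max_card.
Qed.

(** Differentiation lowers the degree by one and multiplication by a variable restores it. Thus
    rotations act on the very space whose kernel is to be shown invariant. *)
Lemma msize_rotd n i j (p : {mpoly R[N]}) :
  (msize p <= n)%N -> (msize (rotd i j p) <= n)%N.
Proof.
move=> pn.
have sum_le (I : eqType) (r : seq I) (F : I -> {mpoly R[N]}) :
    (forall x, x \in r -> (msize (F x) <= n)%N) -> (msize (\sum_(x <- r) F x) <= n)%N.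
  move=> Fn; rewrite big_seq; apply: (big_ind (fun q => (msize q <= n)%N)) => //.
    by rewrite mmeasure0.
  by move=> u v un vn; rewrite (leq_trans (msizeD_le _ _)) // geq_max un.
have XD k l : (msize ('X_k * p^`M(l)) <= n)%N.
  rewrite [p]mpolyE raddf_sum mulr_sumr /=; apply: sum_le => // m mp.
  have mn : (mdeg m < n)%N by exact: leq_trans (msize_mdeg_lt mp) pn.
  rewrite mderivZ mderivX -!scalerAr -mpolyXD.
  have [->|ml] := posnP (m l); first by rewrite scale0r scaler0 mmeasure0.
  apply: leq_trans (msizeZ_le _ _) _; apply: leq_trans (msizeZ_le _ _) _.
  by move: mn; rewrite {1}(mnm_addU ml) msizeX !mdegD !mdeg1.
by rewrite (leq_trans (msizeD_le _ _)) // geq_max msizeN !XD.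
Qed.

Lemma quartic_mpoly n (f : {mpoly R[N]}) : (msize f <= n.+1)%N ->
  T 1 * T (f * f * (f * f)) <= (n.+1 ^ N)%:R * T (f * f) ^+ 2.
Proof.
move=> fn; pose V (p : {mpoly R[N]}) := (msize p <= n.+1)%N : Prop.
pose gs := [seq 'X_[val m] | m <- enum {: 'X_{1..N < n.+1}}] : seq {mpoly R[N]}.
have VD c p q : V p -> V q -> V (c *: p + q).
  move=> Vp Vq; apply: leq_trans (msizeD_le _ _) _.
  by rewrite geq_max Vq andbT (leq_trans (msizeZ_le _ _)).
have V0 : V 0 by rewrite /V mmeasure0.
have Vgs g : g \in gs -> V g.
  by move=> /mapP[m _ ->]; rewrite /V msizeX bmdeg.
have [r [rs [e [Ve oe he]]]] := gram_schmidt T_ge0 VD V0 Vgs.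
(* Gram-Schmidt is run on the monomials of degree at most n; linearity extends the null remainder to
   all of [V]. *)
have hV p : V p -> T ((p - proj T e p) * (p - proj T e p)) = 0.
  move=> Vp; pose D p := p - proj T e p.
  have D_lin : linear D.
    by move=> c u v; rewrite /D proj_linear scalerBr opprD addrACA.
  have DD u v : D (u + v) = D u + D v by rewrite -[u in LHS]scale1r D_lin scale1r.
  have D0 : D 0 = 0 by apply: (addrI (D 0)); rewrite -DD !addr0.
  have DZ c u : D (c *: u) = c *: D u by rewrite -[_ *: _ in LHS]addr0 D_lin D0 addr0.
  rewrite -/(D p) [p in D p]mpolyE (big_morph D DD D0) big_seq.
  elim/big_ind: _ => [|u v u0 v0|m mp]; first by rewrite mul0r linear0.
    exact: nullD.
  have mn : (mdeg m < n.+1)%N by exact: leq_trans (msize_mdeg_lt mp) Vp.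
  rewrite DZ nullZ // he //; apply/mapP; exists (BMultinom mn) => //.
  by rewrite mem_enum.
have kernel_rot i j g : T (rotd i j (kernel e) * g) = 0.
  apply: (@kernel_derivation _ _ T T_ge0 r e (rotd i j) g) => [p q|p q|p|k].
  - exact: rotdM.
  - exact: rotdD.
  - exact: T_rot.2.
  - by apply: hV; apply: msize_rotd; exact: Ve.
(* Since rotations kill K weakly, T with density K is again invariant, hence proportional to T by
   uniqueness: this is the constancy of K. *)
have W_rot : rot_invariant (weighted T (kernel e)).
  split=> [g|i j g]; rewrite /weighted /=; first by rewrite -mulrA T_rot.1.
  have := T_rot.2 i j (g * kernel e); rewrite rotdM linearD /=.
  by rewrite [g * _]mulrC kernel_rot addr0.
apply: le_trans (quartic_bound T_ge0 oe (hV f fn) _) _.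
  have := rot_invariant_unique N_gt1 (f * f) T_rot W_rot.
  by rewrite /weighted /= mul1r [f * f * _]mulrC.
rewrite ler_wpM2r ?sqr_ge0 // ler_nat (leq_trans rs) //.
by rewrite size_map -cardE card_bmultinom.
Qed.

End Quartic.

From mathcomp Require Import all_classical all_reals all_analysis.
From mathcomp Require Import measurable_realfun.
Import numFieldNormedType.Exports.

Local Open Scope classical_set_scope.
Local Open Scope ring_scope.

(** * Integrals of partial derivatives over balls *)

Section Slices.
Context {R : realType}.
Local Notation lam := (@lebesgue_rV R).
Local Notation leb := (@lebesgue_measure R).

Definition sqn n (x : 'rV[R]_n) : R := \sum_(i < n) x ord0 i ^+ 2.

Definition rV_set n (x : 'rV[R]_n) (i : 'I_n) (t : R) : 'rV[R]_n :=
  \row_k if k == i then t else x ord0 k.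

Lemma cons_rV0 n (a : R) (v : 'rV[R]_n) : cons_rV (a, v) ord0 ord0 = a.
Proof. by rewrite /cons_rV mxE unlift_none. Qed.

Lemma cons_rVS n (a : R) (v : 'rV[R]_n) i : cons_rV (a, v) ord0 (lift ord0 i) = v ord0 i.
Proof. by rewrite /cons_rV mxE liftK. Qed.

Lemma rV_set_cons0 n (a t : R) (v : 'rV[R]_n) :
  rV_set (cons_rV (a, v)) ord0 t = cons_rV (t, v).
Proof.
apply/rowP => k; rewrite mxE; case: (unliftP ord0 k) => [j|] ->.
  by rewrite !cons_rVS.
by rewrite !cons_rV0.
Qed.

Lemma rV_set_consS n (a t : R) (v : 'rV[R]_n) j :
  rV_set (cons_rV (a, v)) (lift ord0 j) t = cons_rV (a, rV_set v j t).
Proof.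
apply/rowP => k; rewrite mxE; case: (unliftP ord0 k) => [l|] ->.
  by rewrite !cons_rVS mxE (inj_eq lift_inj).
by rewrite !cons_rV0.
Qed.

Lemma sqn_cons n (a : R) (v : 'rV[R]_n) : sqn (cons_rV (a, v)) = a ^+ 2 + sqn v.
Proof.
by rewrite /sqn big_ord_recl cons_rV0; congr (_ + _); apply: eq_bigr => i _; rewrite cons_rVS.
Qed.

Lemma sqn_ge0 n (x : 'rV[R]_n) : 0 <= sqn x.
Proof. by apply: sumr_ge0 => i _; exact: sqr_ge0. Qed.

Lemma measurable_sqn n : measurable_fun [set: 'rV[R]_n] (@sqn n).
Proof.
by apply: measurable_sum => i; apply: measurable_funX; exact: measurable_coord.
Qed.

(** The parameter is the squared radius, possibly negative, so that fixing a coordinate a gives the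
    ball with parameter c - a^2. *)
Definition sqball n (c : R) : set 'rV[R]_n := [set x | sqn x <= c].

Lemma measurable_sqball n c : measurable (@sqball n c).
Proof.
rewrite (_ : sqball c = @sqn n @^-1` `]-oo, c]%classic).
  by rewrite -[X in measurable X]setTI; exact: measurable_sqn.
by apply/seteqP; split => x /=; rewrite in_itv.
Qed.

Lemma sqball_cons n c : @cons_rV R n @^-1` sqball c `<=`
  `[- (`|c| + 1), `|c| + 1]%classic `*` @sqball n c.
Proof.
move=> [a v]; rewrite /sqball /= sqn_cons in_itv /= => h.
have := sqn_ge0 v; have := sqr_ge0 a; have := ler_norm c; have := normr_ge0 c => *.
split; last by lra.
by apply/andP; split; nra.
Qed.

Lemma sqball_finite n c : (lam n (sqball c) < +oo)%E.
Proof.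
elim: n => [|n IH].
  rewrite /= /dirac /= indicE; exact: ltry.
have mB := @measurable_sqball n c.
have mI : measurable (`[- (`|c| + 1), `|c| + 1]%classic : set R) by [].
change ((leb \x lam n)%E (@cons_rV R n @^-1` sqball c) < +oo)%E.
apply: (@le_lt_trans _ _ ((leb \x lam n)%E (`[- (`|c| + 1), `|c| + 1]%classic `*` sqball c))).
  apply: le_measure; rewrite ?inE.
  - rewrite -[X in measurable X]setTI; apply: measurable_cons_rV => //.
    exact: measurable_sqball.
  - exact: measurableX.
  - exact: sqball_cons.
rewrite product_measure1E // lte_mul_pinfty // ?ge0_fin_numE //.
by rewrite /= lebesgue_measure_itv /=; case: ifP => _; rewrite ltry.
Qed.

(** The domain is the interval between the two square roots of c, where F vanishes at both ends; it
    is empty for c < 0 and a point for c = 0. *)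
Lemma integral_slice (c : R) (F F' : R -> R) :
  (forall t : R, is_derive t 1 F (F' t)) -> continuous F' ->
  (forall t, t ^+ 2 = c -> F t = 0) ->
  (\int[leb]_(t in [set t | (t ^+ 2 <= c)%R]) (F' t)%:E = 0)%E.
Proof.
move=> dF cF' F0; have [c0|c0] := ltP c 0.
  rewrite (_ : [set t | _] = set0) ?integral_set0 //.
  by apply/seteqP; split => // t /=; have := sqr_ge0 t; lra.
pose h := Num.sqrt c.
have hh : h ^+ 2 = c by rewrite sqr_sqrtr.
have h0 : 0 <= h by exact: sqrtr_ge0.
rewrite (_ : [set t | _] = `[- h, h]%classic); last first.
  apply/seteqP; split => t /=; rewrite in_itv /= -hh.
    by move=> ?; apply/andP; split; nra.
  by move=> /andP[? ?]; nra.
move: h0; rewrite le_eqVlt => /orP[/eqP <-|h0].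
  by rewrite oppr0 set_itv1 integral_set1.
rewrite (@continuous_FTC2 _ F' F) //.
- by rewrite (F0 h) // (F0 (- h)) ?sqrrN // subee.
- lra.
- exact: continuous_subspaceT.
- split.
  + by move=> t _; exact: ex_derive.
  + apply: cvg_at_right_filter; apply: differentiable_continuous.
    by apply/derivable1_diffP; exact: ex_derive.
  + apply: cvg_at_left_filter; apply: differentiable_continuous.
    by apply/derivable1_diffP; exact: ex_derive.
- by move=> t _; rewrite derive1E derive_val.
Qed.

(** The divergence theorem for a function vanishing on the boundary sphere, by Fubini and the
    fundamental theorem of calculus along the i-th axis. It is stated for general functions rather
    than polynomials so that the induction on the dimension can freeze the first coordinate. *)
Lemma integral_partial n (i : 'I_n) c (F F' : 'rV[R]_n -> R) :
  measurable_fun [set: 'rV[R]_n] F' ->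
  (exists K, forall x, sqn x <= c -> `|F' x| <= K) ->
  (forall x (t : R), is_derive t 1 (fun u : R => F (rV_set x i u)) (F' (rV_set x i t))) ->
  (forall x, continuous (fun t : R => F' (rV_set x i t))) ->
  (forall x, sqn x = c -> F x = 0) ->
  (\int[lam n]_(x in sqball c) (F' x)%:E = 0)%E.
Proof.
elim: n i c F F' => [[]//|n IH] i c F F' mF' [K F'K] dF cF' F0.
have mB := @measurable_sqball n.+1 c.
pose B := @cons_rV R n @^-1` sqball c.
have mcons : measurable_fun [set: (measurableTypeR R * 'rV[R]_n)%type]
    (@cons_rV R n : _ -> 'rV[R]_n.+1) by exact: measurable_cons_rV.
have mB' : measurable (B : set (measurableTypeR R * 'rV[R]_n)%type).
  by rewrite -[X in measurable X]setTI; exact: mcons.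
pose f := (EFin \o (F' \o @cons_rV R n)) \_ B.
have mF'c : measurable_fun [set: (measurableTypeR R * 'rV[R]_n)%type] (F' \o @cons_rV R n).
  by apply: measurableT_comp => //; exact: measurable_cons_rV.
have intB : (leb \x lam n)%E.-integrable B (EFin \o (F' \o @cons_rV R n)).
  apply: measurable_bounded_integrable => //.
  - exact: (@sqball_finite n.+1 c).
  - exact: measurable_funTS.
  - exists K; split; first exact: num_real.
    move=> M KM p Bp; apply: le_trans (ltW KM); exact: F'K.
have intf : (leb \x lam n)%E.-integrable setT f.
  exact: (proj1 (integrable_mkcond _ mB') intB).
have -> : (\int[lam n.+1]_(x in sqball c) (F' x)%:E = \int[leb \x lam n]_p f p)%E.
  rewrite -integral_mkcond.
  rewrite -(@integral_pushforward _ _ _ _ R _ mcons (leb \x lam n)%E (sqball c)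
    (EFin \o F')) //.
  exact/measurable_EFinP.
case: (unliftP ord0 i) => [j|] iE; rewrite iE in dF cF'.
(* The derivative is along a later coordinate: freeze the first one at a and use induction on the
   ball of parameter c - a^2. *)
- rewrite -integral12_prod_meas1 //; apply: integral0_eq => a _.
  rewrite /fubini_F.
  transitivity (\int[lam n]_(v in sqball (c - a ^+ 2)) (F' (cons_rV (a, v)))%:E)%E.
    rewrite [RHS]integral_mkcond; apply: eq_integral => v _.
    rewrite /f /patch /=; congr (if _ then _ else _).
    by apply/idP/idP; rewrite !inE /B /sqball /= sqn_cons; lra.
  apply: (IH j (c - a ^+ 2) (fun v => F (cons_rV (a, v))) (fun v => F' (cons_rV (a, v)))).
  + apply: (measurableT_comp mF'c); exact: measurable_pair1.
  + by exists K => v hv; apply: F'K; rewrite sqn_cons; lra.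
  + move=> v t; have := dF (cons_rV (a, v)) t; rewrite rV_set_consS.
    by under eq_fun do rewrite rV_set_consS.
  + move=> v; have := cF' (cons_rV (a, v)).
    by under eq_fun do rewrite rV_set_consS.
  + by move=> v hv; apply: F0; rewrite sqn_cons; lra.
(* The derivative is along the first coordinate: integrate it first, over an interval. *)
- rewrite -integral21_prod_meas1 //; apply: integral0_eq => v _.
  rewrite /fubini_G.
  transitivity (\int[leb]_(t in [set t | (t ^+ 2 <= c - sqn v)%R]) (F' (cons_rV (t, v)))%:E)%E.
    rewrite [RHS]integral_mkcond; apply: eq_integral => t _.
    rewrite /f /patch /=; congr (if _ then _ else _).
    by apply/idP/idP; rewrite !inE /B /sqball /= sqn_cons; lra.
  apply: (@integral_slice (c - sqn v) (fun t => F (cons_rV (t, v)))).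
  + move=> t; have := dF (cons_rV (0, v)) t; rewrite rV_set_cons0.
    by under eq_fun do rewrite rV_set_cons0.
  + have := cF' (cons_rV (0, v)).
    by under eq_fun do rewrite rV_set_cons0.
  + by move=> t ht; apply: F0; rewrite sqn_cons; lra.
Qed.

End Slices.

Section PolyFunctions.
Context {R : realType}.
Local Notation lam := (@lebesgue_rV R).
Local Notation leb := (@lebesgue_measure R).

(** Every line parallel to the first axis meets the level set in at most two points; the product
    measure is therefore taken in the order that measures these lines first. *)
Lemma sqn_level_null n c : lam n.+1 [set x | sqn x = c] = 0%E.
Proof.
pose B : set (measurableTypeR R * 'rV[R]_n) := @cons_rV R n @^-1` [set x | sqn x = c].
have mcons : measurable_fun [set: (measurableTypeR R * 'rV[R]_n)%type]
    (@cons_rV R n : _ -> 'rV[R]_n.+1) by exact: measurable_cons_rV.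
have mB : measurable B.
  rewrite -[X in measurable X]setTI; apply: mcons => //.
  rewrite (_ : [set _ | _] = @sqn R n.+1 @^-1` [set c]) //.
  by rewrite -[X in measurable X]setTI; exact: measurable_sqn.
change ((leb \x lam n)%E B = 0%E).
rewrite (@product_measure_unique _ _ _ _ R leb (lam n) (leb \x^ lam n)%E) //; last first.
  by move=> *; exact: product_measure2E.
rewrite /product_measure2; apply: integral0_eq => v _ /=.
apply: countable_lebesgue_measure0; apply: sub_countable (_ : countable [set Num.sqrt (c - sqn v); - Num.sqrt (c - sqn v)]).
  apply: subset_card_le => t; rewrite /ysection /= inE /B /= sqn_cons => h.
  have := sqr_sqrtr (sqr_ge0 t); rewrite (_ : t ^+ 2 = c - sqn v); last by lra.
  move=> hs; have : (t - Num.sqrt (c - sqn v)) * (t + Num.sqrt (c - sqn v)) = 0.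
    by rewrite -subr_sqr hs; lra.
  by move/eqP; rewrite mulf_eq0 subr_eq0 addr_eq0 => /orP[] /eqP ->; [left|right].
exact: finite_set_countable.
Qed.

End PolyFunctions.

(** * Polynomials as functions *)

Section PolyEval.
Context {R : realType} {d : nat}.
Implicit Types (p q : mpoly.mpoly d.+1 R) (x : 'rV[R]_d.+1).
Local Notation mono i := (mpoly.mpolyX R (mpoly.mnm1 i)).

Lemma poly_evalD p q x : poly_eval (p + q) x = poly_eval p x + poly_eval q x.
Proof. exact: mpoly.mevalD. Qed.
Lemma poly_evalB p q x : poly_eval (p - q) x = poly_eval p x - poly_eval q x.
Proof. exact: mpoly.mevalB. Qed.
Lemma poly_evalM p q x : poly_eval (p * q) x = poly_eval p x * poly_eval q x.
Proof. exact: mpoly.mevalM. Qed.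
Lemma poly_evalZ c p x : poly_eval (c *: p) x = c * poly_eval p x.
Proof. exact: mpoly.mevalZ. Qed.
Lemma poly_evalC c x : poly_eval (mpoly.mpolyC d.+1 c) x = c.
Proof. exact: mpoly.mevalC. Qed.
Lemma poly_eval1 x : poly_eval 1 x = 1.
Proof. exact: mpoly.meval1. Qed.
Lemma poly_evalXU i x : poly_eval (mono i) x = x ord0 i.
Proof. exact: mpoly.mevalXU. Qed.
Lemma poly_evalXn p k x : poly_eval (p ^+ k) x = poly_eval p x ^+ k.
Proof.
by elim: k => [|k IH]; rewrite ?expr0 ?poly_eval1 // !exprS poly_evalM IH.
Qed.
Lemma poly_eval_sumsq x : poly_eval sumsq x = sqn x.
Proof.
rewrite /poly_eval /sumsq raddf_sum; apply: eq_bigr => i _ /=.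
by rewrite -[LHS]/(poly_eval (mono i ^+ 2) x) poly_evalXn poly_evalXU.
Qed.

Lemma measurable_poly_eval p : measurable_fun setT (poly_eval p).
Proof.
elim/mpoly_ring_ind: p => [c|i|p q mp mq|p q mp mq].
- by rewrite (_ : poly_eval _ = cst c) //; apply/funext => x; rewrite poly_evalC.
- rewrite (_ : poly_eval _ = fun x => x ord0 i); first exact: measurable_coord.
  by apply/funext => x; rewrite poly_evalXU.
- rewrite (_ : poly_eval _ = poly_eval p \+ poly_eval q); first exact: measurable_funD.
  by apply/funext => x; rewrite poly_evalD.
- rewrite (_ : poly_eval _ = poly_eval p \* poly_eval q); first exact: measurable_funM.
  by apply/funext => x; rewrite poly_evalM.
Qed.

Lemma poly_eval_bounded p c :
  exists K, forall x, (forall i, `|x ord0 i| <= c) -> `|poly_eval p x| <= K.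
Proof.
elim/mpoly_ring_ind: p => [a|i|p q [K hK] [L hL]|p q [K hK] [L hL]].
- by exists `|a| => x _; rewrite poly_evalC.
- by exists c => x hx; rewrite poly_evalXU.
- exists (K + L) => x hx; rewrite poly_evalD.
  by apply: le_trans (ler_normD _ _) _; rewrite lerD ?hK ?hL.
- by exists (K * L) => x hx; rewrite poly_evalM normrM ler_pM ?hK ?hL.
Qed.

Lemma continuous_poly_eval p : continuous (poly_eval p).
Proof.
elim/mpoly_ring_ind: p => [c|i|p q cp cq|p q cp cq].
- rewrite (_ : poly_eval _ = cst c); first exact: cst_continuous.
  by apply/funext => x; rewrite poly_evalC.
- rewrite (_ : poly_eval _ = fun x => x ord0 i); first exact: coord_continuous.
  by apply/funext => x; rewrite poly_evalXU.
- rewrite (_ : poly_eval _ = poly_eval p \+ poly_eval q).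
    by move=> x; exact: (continuousD (cp x) (cq x)).
  by apply/funext => x; rewrite poly_evalD.
- rewrite (_ : poly_eval _ = poly_eval p \* poly_eval q).
    by move=> x; exact: (continuousM (cp x) (cq x)).
  by apply/funext => x; rewrite poly_evalM.
Qed.

Lemma is_derive_poly_eval p i x (t : R) :
  is_derive t 1 (fun u : R => poly_eval p (rV_set x i u))
    (poly_eval (mpoly.mderiv i p) (rV_set x i t)).
Proof.
elim/mpoly_ring_ind: p => [c|j|p q dp dq|p q dp dq].
- rewrite mpoly.mderivC -(mpoly.mpolyC0 d.+1) poly_evalC.
  by under eq_fun do rewrite poly_evalC; exact: is_derive_cst.
- rewrite mderivXU; under eq_fun do rewrite poly_evalXU mxE.
  rewrite [j == i]eq_sym; case: eqVneq => _; rewrite /= ?mulr1n ?mulr0n ?poly_eval1.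
    exact: is_derive_id.
  by rewrite -(mpoly.mpolyC0 d.+1) poly_evalC; exact: is_derive_cst.
- rewrite mpoly.mderivD poly_evalD; under eq_fun do rewrite poly_evalD.
  exact: is_deriveD.
- rewrite mpoly.mderivM poly_evalD !poly_evalM; under eq_fun do rewrite poly_evalM.
  have h := is_deriveM dp dq; apply: (is_derive_eq h).
  by rewrite addrC /GRing.scale /= [poly_eval q _ * _]mulrC.
Qed.

End PolyEval.

(** * Rotational derivatives integrate to zero: from the ball to directions *)

Section Divergence.
Context {R : realType} {d : nat}.
Local Notation N := d.+1.
Local Notation lam := (@lebesgue_rV R N).
Local Notation mono i := (mpoly.mpolyX R (mpoly.mnm1 i)).
Implicit Types (p q : mpoly.mpoly N R) (x : 'rV[R]_N).

Lemma coord_le_sqn x c i : sqn x <= c ^+ 2 -> 0 <= c -> `|x ord0 i| <= c.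
Proof.
move=> xc c0; rewrite -(@ler_pXn2r _ 2%N) ?nnegrE // real_normK ?num_real //.
apply: le_trans xc; rewrite /sqn (bigD1 i) //= lerDl.
by apply: sumr_ge0 => j _; exact: sqr_ge0.
Qed.

Lemma poly_eval_bounded_ball p : exists K, forall x, sqn x <= 1 -> `|poly_eval p x| <= K.
Proof.
have [K hK] := poly_eval_bounded p 1; exists K => x hx; apply: hK => i.
by apply: coord_le_sqn => //; rewrite expr1n.
Qed.

Lemma integrable_poly_eval p (D : set 'rV[R]_N) : measurable D -> D `<=` sqball 1 ->
  lam.-integrable D (EFin \o poly_eval p).
Proof.
move=> mD DB; apply: measurable_bounded_integrable => //.
- apply: le_lt_trans (@sqball_finite R N 1).
  by apply: le_measure; rewrite ?inE //; exact: measurable_sqball.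
- by apply: measurable_funTS; exact: measurable_poly_eval.
- have [K hK] := poly_eval_bounded_ball p; exists K; split; first exact: num_real.
  by move=> M KM x /DB xB; apply: le_trans (ltW KM); exact: hK.
Qed.

(** The factor 1 - |x|^2 vanishes on the unit sphere, so no boundary term appears. *)
Lemma integral_mderiv i p :
  (\int[lam]_(x in sqball 1) (poly_eval (mpoly.mderiv i ((1 - sumsq) * p)) x)%:E = 0)%E.
Proof.
apply: (@integral_partial R N i 1 (poly_eval ((1 - sumsq) * p))).
- exact: measurable_poly_eval.
- exact: poly_eval_bounded_ball.
- by move=> x t; exact: is_derive_poly_eval.
- move=> x t; apply: differentiable_continuous; apply/derivable1_diffP.
  have h := is_derive_poly_eval (mpoly.mderiv i ((1 - sumsq) * p)) i x t.
  exact: ex_derive.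
- by move=> x x1; rewrite poly_evalM poly_evalB poly_eval1 poly_eval_sumsq x1 subrr mul0r.
Qed.

Lemma integral_rotd i j p :
  (\int[lam]_(x in sqball 1) (poly_eval (rotd i j ((1 - sumsq) * p)) x)%:E = 0)%E.
Proof.
have mB := @measurable_sqball R N 1.
(* The rotation field is divergence free: x_i d_j q - x_j d_i q = d_j (x_i q) - d_i (x_j q). *)
have -> : rotd i j ((1 - sumsq) * p) = mpoly.mderiv j ((1 - sumsq) * (mono i * p)) -
    mpoly.mderiv i ((1 - sumsq) * (mono j * p)).
  rewrite ![(1 - sumsq) * (mono _ * p)]mulrCA /rotd; set q := (1 - sumsq) * p.
  rewrite (mpoly.mderivM j (mono i) q) (mpoly.mderivM i (mono j) q) !mderivXU.
  by rewrite [j == i]eq_sym; set b := (i == j)%:R; ring.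
under eq_integral do rewrite poly_evalB EFinB.
rewrite integralB //; try exact: integrable_poly_eval.
by rewrite !integral_mderiv sube0.
Qed.

Definition normalize x : 'rV[R]_N := (enorm x)^-1 *: x.

Lemma enorm_sqr x : enorm x ^+ 2 = sqn x.
Proof. by rewrite sqr_sqrtr ?sqn_ge0. Qed.

Lemma enorm_ge0 x : 0 <= enorm x.
Proof. exact: sqrtr_ge0. Qed.

Lemma measurable_normalize : measurable_fun [set: 'rV[R]_N] normalize.
Proof.
apply/measurable_fun_rVP => i.
rewrite (_ : (fun _ => _) = (fun x => enorm x `^ (-1) * x ord0 i)).
  apply: measurable_funM; last exact: measurable_coord.
  apply: (@measurableT_comp _ _ _ _ _ _ (@powR R ^~ (-1))) => //.
  exact: measurable_enorm.
by apply/funext => x; rewrite mxE powR_inv1// enorm_ge0.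
Qed.

Lemma sqn_normalize x : 0 < enorm x -> sqn (normalize x) = 1.
Proof.
move=> x0; rewrite /sqn; under eq_bigr do rewrite mxE exprMn.
by rewrite -mulr_sumr -/(sqn x) -enorm_sqr -exprMn mulVf ?expr1n ?lt0r_neq0.
Qed.

Definition punctured_ball : set 'rV[R]_N := [set x | 0 < enorm x <= 1].

Lemma measurable_punctured_ball : measurable punctured_ball.
Proof.
rewrite (_ : punctured_ball = @enorm R N @^-1` `]0, 1]%classic).
  by rewrite -[X in measurable X]setTI; exact: measurable_enorm.
by apply/seteqP; split => x /=; rewrite in_itv.
Qed.

Definition open_punctured_ball : set 'rV[R]_N := [set x | 0 < enorm x < 1].

Lemma measurable_open_punctured_ball : measurable open_punctured_ball.
Proof.
rewrite (_ : open_punctured_ball = @enorm R N @^-1` `]0, 1[%classic).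
  by rewrite -[X in measurable X]setTI; exact: measurable_enorm.
by apply/seteqP; split => x /=; rewrite in_itv.
Qed.

Lemma enorm_le1 x : (enorm x <= 1) = (sqn x <= 1).
Proof. by rewrite -enorm_sqr expr_le1 // enorm_ge0. Qed.

Lemma measurable_sqn_level c : measurable [set x : 'rV[R]_N | sqn x = c].
Proof.
rewrite (_ : [set _ | _] = @sqn R N @^-1` [set c]) //.
by rewrite -[X in measurable X]setTI; exact: measurable_sqn.
Qed.

(** Removes the origin, where normalization degenerates, and the unit sphere, where the
    approximation by cut-off polynomials fails; both are null. *)
Lemma integral_ball_open (D : set 'rV[R]_N) (f : 'rV[R]_N -> \bar R) :
  measurable D -> open_punctured_ball `<=` D -> D `<=` sqball 1 -> lam.-integrable D f ->
  (\int[lam]_(x in D) f x = \int[lam]_(x in open_punctured_ball) f x)%E.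
Proof.
move=> mD OD DB intf.
pose Z : set 'rV[R]_N := [set x | sqn x = 0] `|` [set x | sqn x = 1].
have mZ : measurable Z by apply: measurableU; exact: measurable_sqn_level.
rewrite (negligible_integral mZ mD intf).
  congr (integral _ _ _); apply/seteqP; split => x /=.
    move=> [Dx Zx]; rewrite /open_punctured_ball /= lt_neqAle enorm_ge0 andbT eq_sym.
    rewrite lt_neqAle enorm_le1 (DB x Dx) andbT; apply/andP; split.
      by apply/eqP => e0; apply: Zx; left; rewrite /= -enorm_sqr e0 expr0n.
    by apply/eqP => e1; apply: Zx; right; rewrite /= -enorm_sqr e1 expr1n.
  move=> Ox; split; first exact: OD.
  move: Ox => /andP[x0 x1]; rewrite /Z /= -enorm_sqr => -[|] /eqP.
    by rewrite sqrf_eq0 gt_eqF.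
  by rewrite sqrp_eq1 ?enorm_ge0 // lt_eqF.
apply: null_set_setU; [exact: measurable_sqn_level|exact: measurable_sqn_level|..].
  exact: (@sqn_level_null R d 0).
exact: (@sqn_level_null R d 1).
Qed.

Lemma poly_eval_dhomog l p x : p \is mpoly.ishomog1 l mpoly.mdeg -> 0 < enorm x ->
  poly_eval p x = enorm x ^+ l * poly_eval p (normalize x).
Proof.
move=> hp x0; rewrite /poly_eval -(meval_dhomog _ _ hp); apply: mpoly.meval_eq => i.
by rewrite mxE mulrA divff ?mul1r ?lt0r_neq0.
Qed.

(** The k-th approximation of 1/|x| multiplied by |x|, so that the expected limit is 1. *)
Definition scaled_newton x k := enorm x * poly_eval (newton k) x.

Lemma scaled_newton0 x : scaled_newton x 0 = enorm x.
Proof. by rewrite /scaled_newton poly_eval1 mulr1. Qed.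

Lemma scaled_newtonS x k :
  scaled_newton x k.+1 = scaled_newton x k * (3 - scaled_newton x k ^+ 2) / 2.
Proof.
rewrite /scaled_newton /= poly_evalZ poly_evalM poly_evalB poly_evalC poly_evalM.
by rewrite poly_evalXn poly_eval_sumsq -enorm_sqr; ring.
Qed.

(** One step sends the error 1 - z to (1 - z)(1 - (z + z^2)/2). As z stays between |x| and 1, the
    error shrinks at least by the factor 1 - |x|/2. *)
Lemma scaled_newton_bounds x k : 0 < enorm x < 1 ->
  [/\ enorm x <= scaled_newton x k, scaled_newton x k <= 1 &
      1 - scaled_newton x k <= (1 - enorm x / 2) ^+ k].
Proof.
move=> /andP[r0 r1]; elim: k => [|k [h1 h2 h3]].
  by rewrite scaled_newton0 expr0; split; lra.
rewrite scaled_newtonS; set z := scaled_newton x k in h1 h2 h3 *.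
have z1 : 1 - z * (3 - z ^+ 2) / 2 = (1 - z) * (1 - (z + z ^+ 2) / 2) by field.
have e0 : 0 <= (1 - enorm x / 2) ^+ k by apply: exprn_ge0; lra.
have u0 : 0 <= 1 - (z + z ^+ 2) / 2 by nra.
have u1 : 1 - (z + z ^+ 2) / 2 <= 1 - enorm x / 2 by nra.
split.
- rewrite (le_trans h1) // -subr_ge0.
  have -> : z * (3 - z ^+ 2) / 2 - z = z * (1 - z ^+ 2) / 2 by field.
  have z0 : 0 <= z by lra.
  by apply: divr_ge0 => //; apply: mulr_ge0 => //; nra.
- by rewrite -subr_ge0 z1; apply: mulr_ge0 => //; lra.
- rewrite z1 [X in X <= _]mulrC [X in _ <= X]exprS; apply: ler_pM => //; lra.
Qed.

Lemma scaled_newton_cvg x : 0 < enorm x < 1 -> scaled_newton x @ \oo --> (1 : R).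
Proof.
move=> rx; have /andP[r0 r1] := rx.
have c1 : (fun k => 1 - (1 - enorm x / 2) ^+ k) @ \oo --> (1 : R).
  rewrite -[X in _ --> X]subr0; apply: cvgB; first exact: cvg_cst.
  by apply: cvg_expr; rewrite ger0_norm; lra.
have sq : \forall k \near \oo, 1 - (1 - enorm x / 2) ^+ k <= scaled_newton x k <= (cst 1 : nat -> R) k.
  apply: nearW => k; have [h1 h2 h3] := scaled_newton_bounds k rx.
  by apply/andP; split; rewrite /=; lra.
exact: (squeeze_cvgr sq c1 (cvg_cst _)).
Qed.

(** For h homogeneous of degree l, h(x/|x|) = |x|^(-l) h(x) is not a polynomial, but it is a bounded
    pointwise limit of polynomials [rotd i j (P k)], each of which has integral zero over the
    ball. *)
Lemma integral_rotd_normalize i j m :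
  (\int[lam]_(x in open_punctured_ball)
     (poly_eval (rotd i j (mpoly.mpolyX R m)) (normalize x))%:E = 0)%E.
Proof.
set h := rotd i j _; pose l := mpoly.mdeg m.
have hom : h \is mpoly.ishomog1 l mpoly.mdeg.
  by apply: dhomog_rotd; rewrite mpoly.dhomogX.
have mO := measurable_open_punctured_ball.
have OB : open_punctured_ball `<=` sqball 1.
  by move=> x /andP[_ /ltW]; rewrite enorm_le1.
(* The power of [newton k] approximates |x|^(-l). The cut-off 1 - |x|^(2k) tends to 1 inside the
   ball and, being divisible by 1 - |x|^2, makes [integral_rotd] applicable. *)
pose P k : mpoly.mpoly N R := (1 - sumsq ^+ k) * (newton k ^+ l * mpoly.mpolyX R m).
pose f_ k x := (poly_eval (rotd i j (P k)) x)%:E.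
have int_f k : (\int[lam]_(x in open_punctured_ball) f_ k x = 0)%E.
  rewrite -(@integral_ball_open (sqball 1)) //.
  - rewrite /f_; have -> : P k = (1 - sumsq) * ((\sum_(a < k) sumsq ^+ a) * (newton k ^+ l * mpoly.mpolyX R m)).
      have sE : 1 - sumsq ^+ k = (1 - sumsq) * (\sum_(a < k) sumsq ^+ a) :> mpoly.mpoly N R.
        by apply: oppr_inj; rewrite opprB subrX1 -mulNr opprB.
      by rewrite /P sE -mulrA.
    exact: integral_rotd.
  - exact: measurable_sqball.
  - by apply: integrable_poly_eval => //; exact: measurable_sqball.
have f_E k x : open_punctured_ball x -> poly_eval (rotd i j (P k)) x =
    (1 - (enorm x ^+ 2) ^+ k) * scaled_newton x k ^+ l * poly_eval h (normalize x).
  (* Both radial factors are killed by [rotd], which therefore falls on the monomial alone. *)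
  move=> /andP[x0 _]; rewrite /P rotdM (_ : rotd i j (1 - sumsq ^+ k) = 0); last first.
    by rewrite -scaleN1r rotdD rotdZ rotd1 rotdX ?rotd_sumsq // scaler0 addr0.
  rewrite mul0r add0r rotdM rotdX ?rotd_newton // mul0r add0r -/h.
  rewrite !poly_evalM poly_evalB poly_eval1 !poly_evalXn poly_eval_sumsq -enorm_sqr.
  by rewrite (poly_eval_dhomog hom) // /scaled_newton [(_ * poly_eval _ x) ^+ l]exprMn -!mulrA;
  congr (_ * _); rewrite mulrCA.
have [K hK] := poly_eval_bounded_ball h.
have Knorm x : open_punctured_ball x -> `|poly_eval h (normalize x)| <= K.
  by move=> /andP[x0 _]; apply: hK; rewrite sqn_normalize.
(* Each radial factor lies in [0, 1], so the constant K dominates; it is written as a polynomial to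
   inherit integrability. *)
pose g := EFin \o poly_eval (mpoly.mpolyC N K).
have mf_ k : measurable_fun open_punctured_ball (f_ k).
  by apply: measurable_funTS; apply/measurable_EFinP; exact: measurable_poly_eval.
have mh : measurable_fun open_punctured_ball (fun x => (poly_eval h (normalize x))%:E).
  apply: measurable_funTS; apply/measurable_EFinP.
  by apply: measurableT_comp; [exact: measurable_poly_eval|exact: measurable_normalize].
have f_h x : open_punctured_ball x -> f_ ^~ x @ \oo --> (poly_eval h (normalize x))%:E.
  move=> Ox; have /andP[x0 x1] := Ox; apply: cvg_EFin; first exact: nearW.
  rewrite (_ : _ \o _ = fun k => (1 - (enorm x ^+ 2) ^+ k) * scaled_newton x k ^+ l *
    poly_eval h (normalize x)); last by apply/funext => k; exact: f_E.
  have c1 : (fun k => 1 - (enorm x ^+ 2) ^+ k) @ \oo --> (1 : R).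
    rewrite -[X in _ --> X]subr0; apply: cvgB; first exact: cvg_cst.
    apply: cvg_expr; rewrite ger0_norm ?sqr_ge0 //.
    by rewrite expr_lt1 ?enorm_ge0.
  have c2 : (fun k => scaled_newton x k ^+ l) @ \oo --> (1 : R).
    rewrite -[X in _ --> X](expr1n _ l).
    apply: (@continuous_cvg _ _ _ _ _ _ (fun u : R => u ^+ l)).
      exact: exprn_continuous.
    exact: scaled_newton_cvg.
  have := cvgM (cvgM c1 c2) (cvg_cst (poly_eval h (normalize x))).
  by rewrite !mul1r; apply.
have ig : lam.-integrable open_punctured_ball g by exact: integrable_poly_eval.
have f_g x k : open_punctured_ball x -> (`|f_ k x| <= g x)%E.
  move=> Ox; rewrite /f_ /g /= lee_fin poly_evalC f_E // !normrM.
  have /andP[x0 x1] := Ox; have [z0 z1 _] := scaled_newton_bounds k Ox.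
  have e0 : 0 <= (enorm x ^+ 2) ^+ k by rewrite exprn_ge0 // sqr_ge0.
  have e1 : (enorm x ^+ 2) ^+ k <= 1 by rewrite exprn_ile1 ?sqr_ge0 // expr_le1 // ltW.
  have w0 : 0 <= scaled_newton x k ^+ l by rewrite exprn_ge0 // (le_trans (ltW x0)).
  have w1 : scaled_newton x k ^+ l <= 1 by rewrite exprn_ile1 // (le_trans (ltW x0)).
  rewrite -[K]mul1r; apply: ler_pM; rewrite ?mulr_ge0 ?normr_ge0 ?Knorm //.
  by rewrite !ger0_norm ?subr_ge0 // mulr_ile1 ?subr_ge0 // lerBlDr lerDl.
have [_ _] := @dominated_convergence _ _ R lam open_punctured_ball mO f_ _ g mf_ mh
  (aeW _ f_h) ig (aeW _ f_g).
rewrite (_ : (fun k => _) = cst 0%E); last by apply/funext => k; exact: int_f.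
by move=> /cvg_lim <- //; rewrite lim_cst.
Qed.

End Divergence.

(** * The surface integral as an invariant positive functional *)

Section SphereFunctional.
Context {R : realType} {d : nat}.
Local Notation N := d.+1.
Local Notation lam := (@lebesgue_rV R N).
Local Notation surf := (@surface_measure R d).
Local Notation S := (@sphere R d).
Implicit Types (p q : mpoly.mpoly N R) (x : 'rV[R]_N).

(** Points outside the unit ball go to 0, which is off the sphere, and so does the origin since 0^-1
    = 0. Hence the preimage of a subset of the sphere is exactly its cone. *)
Definition radial x : 'rV[R]_N := if enorm x <= 1 then normalize x else 0.

Lemma measurable_radial : measurable_fun [set: 'rV[R]_N] radial.
Proof.
apply: measurable_fun_ifT; [|exact: measurable_normalize|exact: measurable_cst].
apply: measurable_fun_ler; [exact: measurable_enorm|exact: measurable_cst].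
Qed.

Lemma measurable_sphere : measurable S.
Proof.
rewrite (_ : S = @enorm R N @^-1` [set 1]) //.
by rewrite -[X in measurable X]setTI; exact: measurable_enorm.
Qed.

Lemma enorm0 : enorm (0 : 'rV[R]_N) = 0.
Proof. by rewrite /enorm big1 ?sqrtr0 // => i _; rewrite mxE expr0n. Qed.

Lemma sphere_sqn x : S x <-> sqn x = 1.
Proof.
rewrite -enorm_sqr; split=> [->|/eqP]; first by rewrite expr1n.
by rewrite sqrp_eq1 ?enorm_ge0 // => /eqP.
Qed.

Lemma cone_radial A : A `<=` S -> cone A = radial @^-1` A.
Proof.
have S0 : ~ S 0 by rewrite /sphere /= enorm0 => /eqP; rewrite eq_sym oner_eq0.
move=> AS; apply/seteqP; split => x; rewrite /cone /preimage /= /radial.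
  by move=> [/andP[_ x1] Ax]; rewrite x1.
case: ifP => [x1 Ax|_ /AS /S0 //]; split => //; rewrite andbT lt_neqAle enorm_ge0 andbT.
by apply/eqP => x0; apply: S0; move/AS: Ax; rewrite /normalize -x0 invr0 scale0r.
Qed.

Lemma preimage_radial : radial @^-1` S = @punctured_ball R d.
Proof.
rewrite -cone_radial //; apply/seteqP; split => x; first by case.
move=> x01; split => //; have /andP[x0 _] := x01.
exact/sphere_sqn/sqn_normalize.
Qed.

(** On subsets of the sphere the surface measure is d+1 times the pushforward of Lebesgue measure
    under [radial]; this is the change of variables. *)
Lemma ge0_surface_integral (g : 'rV[R]_N -> \bar R) :
  measurable_fun setT g -> (forall x, (0 <= g x)%E) ->
  (\int[surf]_(x in S) g x =
   d.+1%:R%:E * \int[lam]_(x in @punctured_ball R d) g (normalize x))%E.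
Proof.
move=> mg g0; have mS := measurable_sphere.
transitivity (d.+1%:R%:E * \int[lam]_(x in radial @^-1` S) (g \o radial) x)%E; last first.
  congr (_ * _)%E; rewrite preimage_radial; apply: eq_integral => x.
  by rewrite inE => /andP[_ x1]; rewrite /radial /= x1.
rewrite -(@ge0_integral_pushforward _ _ _ _ R radial measurable_radial lam S g) //; last first.
  exact: measurable_funTS.
rewrite -[d.+1%:R%:E]/((NngNum (ler0n R N))%:num%:E) -ge0_integral_mscale //; last first.
  exact: measurable_funTS.
2: exact: measurable_radial.
move=> mr; apply: eq_measure_integral => A mA AS.
change (surf A = (d.+1%:R%:E * lam (radial @^-1` A))%E).
by rewrite -cone_radial.
Qed.

Lemma surface_integral (f : 'rV[R]_N -> R) : measurable_fun setT f ->
  lam.-integrable (@punctured_ball R d) (EFin \o (f \o @normalize R d)) ->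
  (\int[surf]_(x in S) (f x)%:E =
   d.+1%:R%:E * \int[lam]_(x in @punctured_ball R d) (f (normalize x))%:E)%E.
Proof.
move=> mf intf.
have mfE : measurable_fun setT (EFin \o f) by exact/measurable_EFinP.
have mpb := @measurable_punctured_ball R d.
rewrite integralE !ge0_surface_integral //; try by [exact: measurable_funepos|exact: measurable_funeneg].
rewrite [in RHS]integralE -muleBr //.
  by congr (_ * (_ - _))%E; apply: eq_integral => x _; rewrite !(funeposE, funenegE).
apply: fin_num_adde_defl; rewrite fin_numN.
rewrite (_ : integral _ _ _ = \int[lam]_(x in @punctured_ball R d)
  ((EFin \o (f \o @normalize R d))^\- x))%E; first exact: integrable_neg_fin_num.
by apply: eq_integral => x _; rewrite !funenegE.
Qed.

Lemma measurable_poly_eval_normalize p :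
  measurable_fun setT (poly_eval p \o @normalize R d).
Proof.
apply: measurableT_comp; [exact: measurable_poly_eval|exact: measurable_normalize].
Qed.

Lemma punctured_ball_sub : @punctured_ball R d `<=` sqball 1.
Proof. by move=> x /andP[_]; rewrite enorm_le1. Qed.

Lemma punctured_ball_finite : (lam (@punctured_ball R d) < +oo)%E.
Proof.
apply: le_lt_trans (@sqball_finite R N 1); apply: le_measure; rewrite ?inE.
- exact: measurable_punctured_ball.
- exact: measurable_sqball.
- exact: punctured_ball_sub.
Qed.

Lemma sphere_finite : (surf S < +oo)%E.
Proof.
change (d.+1%:R%:E * lam (cone S) < +oo)%E.
rewrite cone_radial // preimage_radial lte_mul_pinfty //.
exact: punctured_ball_finite.
Qed.

Lemma integrable_normalize p :
  lam.-integrable (@punctured_ball R d) (EFin \o (poly_eval p \o @normalize R d)).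
Proof.
apply: measurable_bounded_integrable.
- exact: measurable_punctured_ball.
- exact: punctured_ball_finite.
- by apply: measurable_funTS; exact: measurable_poly_eval_normalize.
- have [K hK] := poly_eval_bounded_ball p; exists K; split; first exact: num_real.
  move=> M KM x /andP[x0 _]; apply: le_trans (ltW KM); apply: hK.
  by rewrite sqn_normalize.
Qed.

Lemma integrable_sphere p : surf.-integrable S (EFin \o poly_eval p).
Proof.
apply: measurable_bounded_integrable.
- exact: measurable_sphere.
- exact: sphere_finite.
- by apply: measurable_funTS; exact: measurable_poly_eval.
- have [K hK] := poly_eval_bounded_ball p; exists K; split; first exact: num_real.
  move=> M KM x /sphere_sqn x1; apply: le_trans (ltW KM); apply: hK.
  by rewrite x1.
Qed.

Lemma sphere_mean_is_scalar :
  scalar (fun p => (\int[surf]_(x in S) poly_eval p x)%R : R).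
Proof.
move=> c p q; rewrite -RintegralZl ?integrable_sphere //; last exact: measurable_sphere.
rewrite -RintegralD //; last 3 first.
- exact: measurable_sphere.
- have := integrable_sphere (c *: p); congr (integrable _ _ _).
  by apply/funext => x /=; rewrite poly_evalZ.
- exact: integrable_sphere.
by apply: eq_Rintegral => x _; rewrite poly_evalD poly_evalZ.
Qed.

Definition sphere_functional : {scalar mpoly.mpoly N R} :=
  HB.pack (fun p => (\int[surf]_(x in S) poly_eval p x)%R : R)
    (GRing.isLinear.Build R (mpoly.mpoly N R) R _ _ sphere_mean_is_scalar).

Lemma sphere_functionalE p :
  sphere_functional p = (\int[surf]_(x in S) poly_eval p x)%R.
Proof. by []. Qed.

Lemma sphere_functional_ge0 p : 0 <= sphere_functional (p * p).
Proof.
rewrite sphere_functionalE; apply: Rintegral_ge0 => x _.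
by rewrite poly_evalM -expr2 sqr_ge0.
Qed.

Lemma sphere_functional1 : sphere_functional 1 = sphere_area d.
Proof.
rewrite sphere_functionalE /sphere_area /Rintegral; congr fine.
under eq_integral do rewrite poly_eval1.
by rewrite integral_cst ?mul1e //; exact: measurable_sphere.
Qed.

Lemma sphere_functional_rot : rot_invariant sphere_functional.
Proof.
split=> [g|i j g].
  rewrite !sphere_functionalE; apply: eq_Rintegral => x; rewrite inE => /sphere_sqn x1.
  by rewrite poly_evalM poly_eval_sumsq x1 mul1r.
(* Linearity reduces to monomials, whose rotations are homogeneous as [integral_rotd_normalize]
   requires. *)
elim/mpoly.mpolyind: g => [|c m p _ _ IH].
  have -> : rotd i j 0 = 0 :> mpoly.mpoly N R by rewrite -[0 in LHS](scale0r 0) rotdZ scale0r.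
  exact: linear0.
rewrite rotdD rotdZ linearD IH addr0 linearZ.
change (c * sphere_functional (rotd i j (mpoly.mpolyX R m)) = 0).
rewrite sphere_functionalE /Rintegral surface_integral.
- rewrite (integral_ball_open (measurable_punctured_ball)) //.
  + by rewrite integral_rotd_normalize mule0 mulr0.
  + by move=> x /andP[x0 x1]; rewrite /punctured_ball /= x0 ltW.
  + exact: punctured_ball_sub.
  + exact: integrable_normalize.
- exact: measurable_poly_eval.
- exact: integrable_normalize.
Qed.

End SphereFunctional.

(** * Lower bounds for the dimensions of harmonic spaces *)

Lemma expn_fact n e : (n`! * n.+1 ^ e <= (n + e)`!)%N.
Proof.
elim: e => [|e IH]; first by rewrite expn0 muln1 addn0.
rewrite addnS factS expnSr mulnA mulnC; apply: leq_mul => //.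
by rewrite ltnS leq_addr.
Qed.

(** In (d-1)! Z(d,n) = (2n+d-1) (n+d-2)!/n!, valid for n > 0, the first factor is at least n+1 and
    the quotient of factorials is a product of d-2 factors that are at least n+1. *)
Lemma dim_harm_ge d n : (1 < d)%N -> (n.+1 ^ d.-1 <= (d - 1)`! * dim_harm d n)%N.
Proof.
move=> d1; case: n => [|n]; first by rewrite exp1n muln1 fact_gt0.
rewrite -(@leq_pmul2r n.+1`!) ?fact_gt0 // [((d - 1)`! * _)%N]mulnC -mulnA.
rewrite dim_harmE //; have [e ->] : exists e, d = e.+2.
  by case: d d1 => [|[|e]] // _; exists e.
rewrite /= (_ : n.+1 + e.+2 - 2 = n.+1 + e)%N; last by lia.
rewrite expnS -mulnA; apply: leq_mul; first by lia.
by rewrite mulnC expn_fact.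
Qed.

(** The two bounds multiply to the power (d-1) + d = 2d-1 of n+1, and 2d-1 >= d+1 for d >= 2. This
    surplus absorbs the crude count of monomials in d+1 variables. *)
Lemma dim_harm_mul_ge d n : (1 < d)%N ->
  (n.+1 ^ d.+1 <= (d - 1)`! * d`! * (dim_harm d n * dim_harm d.+1 n))%N.
Proof.
move=> d1; have h1 := dim_harm_ge n d1; have h2 := dim_harm_ge n (ltnW d1 : 1 < d.+1)%N.
rewrite subSS subn0 /= in h2.
rewrite mulnACA; apply: leq_trans (leq_mul h1 h2).
by rewrite -expnD leq_pexp2l //; lia.
Qed.

(** * Sobolev norms of polynomials *)

Section SobolevNorm.
Context {R : realType} {d : nat}.
Hypothesis d_gt1 : (1 < d)%N.
Local Notation N := d.+1.
Local Notation surf := (@surface_measure R d).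
Local Notation S := (@sphere R d).
Local Notation T := (@sphere_functional R d).
Variables (a : nat -> R) (Y : forall l, 'I_(dim_harm d l) -> 'rV[R]_N -> R).
Hypothesis basisY : harmonic_basis Y.
Implicit Types (p q : mpoly.mpoly N R) (f : 'rV[R]_N -> R).

Let N_gt1 : (1 < N)%N. Proof. exact: ltnW. Qed.

Lemma basis_spherical_harmonic l (k : 'I_(dim_harm d l)) : spherical_harmonic l (Y k).
Proof. by have [h _ _] := basisY l; exact: h. Qed.

(** A chosen homogeneous harmonic representative of Y_{l,k}, which turns Fourier coefficients into
    values of T. *)
Definition harmonic_poly l (k : 'I_(dim_harm d l)) : mpoly.mpoly N R :=
  projT1 (cid (basis_spherical_harmonic k)).

Lemma harmonic_polyP l (k : 'I_(dim_harm d l)) :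
  [/\ harmonic_poly k \is mpoly.ishomog1 l mpoly.mdeg,
      laplacian (harmonic_poly k) = 0 &
      forall x, S x -> Y k x = poly_eval (harmonic_poly k) x].
Proof. exact: projT2 (cid (basis_spherical_harmonic k)). Qed.

Lemma Rintegral_sphere f p : (forall x, S x -> f x = poly_eval p x) ->
  \int[surf]_(x in S) f x = T p.
Proof. by move=> fp; apply: eq_Rintegral => x; rewrite inE => /fp. Qed.

Lemma fourier_coefE f p l (k : 'I_(dim_harm d l)) :
  (forall x, S x -> f x = poly_eval p x) ->
  fourier_coef Y f k = T (p * harmonic_poly k).
Proof.
move=> fp; have [_ _ Yk] := harmonic_polyP k.
by apply: Rintegral_sphere => x Sx; rewrite /= fp // Yk // poly_evalM.
Qed.

Lemma harmonic_poly_orthogonal l (k : 'I_(dim_harm d l)) p :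
  (mpoly.mmeasure mpoly.mdeg p <= l)%N -> T (harmonic_poly k * p) = 0.
Proof.
have [hk lk _] := harmonic_polyP k => pl.
exact: (harmonic_orthogonal N_gt1 (sphere_functional_rot) hk lk pl).
Qed.

Lemma msize_harmonic_poly l (k : 'I_(dim_harm d l)) :
  (mpoly.mmeasure mpoly.mdeg (harmonic_poly k) <= l.+1)%N.
Proof.
have [hk _ _] := harmonic_polyP k.
rewrite mpoly.mmeasureE; apply/bigmax_leqP_seq => m mk _.
by rewrite (mpoly.dhomog_mf hk mk).
Qed.

(** Within one degree this is the assumption on the basis; across degrees it is
    [harmonic_orthogonal], applied to the harmonic of larger degree. Pairs (l, k) with l < L form a
    single finite index type, so that [bessel] applies. *)
Lemma harmonic_poly_orthonormal L :
  @orthonormal_family R _ T {l : 'I_L & 'I_(dim_harm d l)}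
    (fun i => harmonic_poly (tagged i)).
Proof.
move=> [l k] [l' k'] /=.
have [e|ne] := eqVneq l l'.
  move: k'; rewrite -e => k'; rewrite eq_Tagged /=.
  have [_ Yo _] := basisY l; rewrite -Yo.
  have [_ _ Yk] := harmonic_polyP k; have [_ _ Yk'] := harmonic_polyP k'.
  by apply/esym; apply: Rintegral_sphere => x Sx; rewrite /= Yk // Yk' // poly_evalM.
rewrite [_ == _](_ : _ = false); last first.
  by apply/eqP => /(congr1 tag) /= /eqP; rewrite (negPf ne).
have [ll|ll|/ord_inj e] := ltngtP l l'; last by rewrite e eqxx in ne.
  by rewrite mulrC; apply: harmonic_poly_orthogonal; exact: leq_trans (msize_harmonic_poly k) ll.
by apply: harmonic_poly_orthogonal; exact: leq_trans (msize_harmonic_poly k') ll.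
Qed.

Lemma harmonic_bessel L p :
  \sum_(l < L) \sum_(k < dim_harm d l) T (p * harmonic_poly k) ^+ 2 <= T (p * p).
Proof.
rewrite (@sig_big_dep _ _ _ 'I_L (fun l => 'I_(dim_harm d l)) predT (fun=> predT)
  (fun l k => T (p * harmonic_poly k) ^+ 2)) /=.
exact: (bessel (@sphere_functional_ge0 R d) p (@harmonic_poly_orthonormal L)).
Qed.

(** The size of p exceeds its degree by one, so every l >= L is above the degree and its
    coefficients vanish by orthogonality; the series is a finite sum. *)
Lemma sobolev_sqnorm_poly f p L : (forall x, S x -> f x = poly_eval p x) ->
  (mpoly.mmeasure mpoly.mdeg p <= L)%N ->
  sobolev_sqnorm a Y f =
    (\sum_(l < L) \sum_(k < dim_harm d l) (a l)^-1 * T (p * harmonic_poly k) ^+ 2)%:E.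
Proof.
move=> fp pL; rewrite /sobolev_sqnorm.
pose u l := \sum_(k < dim_harm d l) (a l)^-1 * `|fourier_coef Y f k| ^+ 2.
have u0 l : (L <= l)%N -> u l = 0.
  move=> Ll; apply: big1 => k _; rewrite (fourier_coefE _ fp) [p * _]mulrC.
  by rewrite harmonic_poly_orthogonal ?(leq_trans pL) // normr0 expr0n mulr0.
transitivity (\sum_(0 <= l < L) (u l)%:E)%E.
  apply: lim_near_cst => //; exists L => // l /= Ll.
  change (\sum_(0 <= k < l) (u k)%:E = \sum_(0 <= k < L) (u k)%:E)%E.
  rewrite (big_cat_nat (leq0n L) Ll) /= -[RHS]adde0; congr (_ + _)%E.
  by rewrite big_nat big1 // => k /andP[/u0 -> _].
rewrite sumEFin big_mkord; congr EFin; apply: eq_bigr => l _; apply: eq_bigr => k _.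
by rewrite (fourier_coefE _ fp) real_normK ?num_real.
Qed.

Lemma sobolev_poly f p : (forall x, S x -> f x = poly_eval p x) -> sobolev a Y f.
Proof.
move=> fp; have mS := @measurable_sphere R d; split.
- apply: (@subspace_eq_continuous _ S R (poly_eval p : subspace S -> R)).
    by move=> x; rewrite inE => /fp.
  by apply: continuous_subspaceT; exact: continuous_poly_eval.
- split.
    apply: (eq_measurable_fun (poly_eval p)); first by move=> x; rewrite inE => /fp.
    by apply: measurable_funTS; exact: measurable_poly_eval.
  rewrite (_ : integral _ _ _ = \int[surf]_(x in S) (poly_eval (p * p) x)%:E)%E; last first.
    apply: eq_integral => x; rewrite inE => /fp ->.
    by rewrite real_normK ?num_real // poly_evalM expr2.
  have /integrable_fin_num := integrable_sphere (p * p).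
  by move=> /(_ mS); rewrite fin_numE ltey => /andP[].
- by rewrite (sobolev_sqnorm_poly fp (leqnn _)) ltry.
Qed.

End SobolevNorm.

(* The constant comes from [(n + 1)^(d+1) <= (d-1)! d! Z(d,n) Z(d+1,n)] and the
   lower bound [c1] in the comparison of [a] with [(1 + l)^(-2s)]. *)
Definition mz_constant {R : realType} (d : nat) (c1 : R) : R :=
  Num.sqrt (((d - 1)`! * d`!)%:R / c1).

(** * From the quadrature error to the Marcinkiewicz-Zygmund bound *)

(** The range l <= 2n is that of the degrees in chi^2; this is the origin of the factor (2n+1)^s in
    eta. *)
Lemma weighted_sqnorm_le {R : realType} (s c1 : R) (a : nat -> R) n l (b : R) :
  0 < c1 -> 0 <= s -> (l <= 2 * n)%N -> 0 <= b ->
  c1 * (1 + l%:R) `^ (- (2 * s)) <= a l ->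
  (a l)^-1 * b <= c1^-1 * ((2 * n%:R + 1) `^ s) ^+ 2 * b.
Proof.
move=> c10 s0 ln b0 al; apply: ler_wpM2r => //.
have l0 : 0 < (1 + l%:R : R) by rewrite ltr_pwDl.
have p0 : 0 < (1 + l%:R : R) `^ (- (2 * s)) by exact: powR_gt0.
have -> : ((2 * n%:R + 1 : R) `^ s) ^+ 2 = (2 * n%:R + 1) `^ (2 * s).
  by rewrite [2 * s]mulrC powRrM powR_mulrn ?powR_ge0.
apply: (@le_trans _ _ (c1 * (1 + l%:R) `^ (- (2 * s)))^-1).
  by rewrite lef_pV2 // posrE ?mulr_gt0 // (lt_le_trans _ al) // mulr_gt0.
rewrite invfM powRN invrK ler_wpM2l ?invr_ge0 ?(ltW c10) //.
apply: ge0_ler_powR; rewrite ?nnegrE ?mulr_ge0 ?addr_ge0 //.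
by rewrite addrC lerD2r -natrM ler_nat.
Qed.

Theorem mainTheorem5 (R : realType) (d : nat) (s : R) (a : nat -> R)
    (hd : (2 <= d)%N) (hs : d%:R / 2 < s)
    (ha0 : forall l, 0 < a l) (ha : comparable_weights s a) :
  exists2 ctilde : R, 0 < ctilde &
    forall Y : forall l, 'I_(dim_harm d l) -> 'rV[R]_d.+1 -> R,
    harmonic_basis Y ->
    forall (M : set nat) (X : forall m, 'I_m -> 'rV[R]_d.+1) (c : R),
    QMC_designs s a Y M X c ->
    forall n m : nat, M m ->
    let eta := c * ctilde / m%:R `^ (s / d%:R) * (2 * n%:R + 1) `^ s *
      Num.sqrt ((dim_harm d n)%:R / sphere_area d * (dim_harm d.+1 n)%:R) in
    0 < eta < 1 ->
    forall chi : 'rV[R]_d.+1 -> R, sphere_poly n chi ->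
      `|sphere_area d / m%:R * (\sum_(j < m) chi (X m j) ^+ 2)
        - \int[surface_measure d]_(x in sphere d) (chi x ^+ 2)|
      <= eta * \int[surface_measure d]_(x in sphere d) (chi x ^+ 2).
Proof.
have [c1 [c2 [c1_gt0 _ hc1]]] := ha.
pose K : R := ((d - 1)`! * d`!)%:R.
have K_gt0 : 0 < K by rewrite ltr0n muln_gt0 !fact_gt0.
have s_ge0 : 0 <= s by apply: le_trans (ltW hs); rewrite divr_ge0.
exists (mz_constant d c1); first by rewrite sqrtr_gt0 divr_gt0.
move=> Y basisY M X c [_ _ c_gt0 qmc] n m Mm eta /andP[eta_gt0 _] chi [p pn chip].
set A := sphere_area d; set I := Rintegral _ _ _.
have A_ge0 : 0 <= A by exact: fine_ge0.
(* Read off from eta > 0: if the area were 0, the convention 0^-1 = 0 would make the square root in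
   eta vanish. *)
have A_gt0 : 0 < A.
  rewrite lt_neqAle A_ge0 andbT eq_sym; apply/eqP => A0.
  by move: eta_gt0; rewrite /eta -/A A0 invr0 mulr0 mul0r sqrtr0 mulr0 ltxx.
pose T := @sphere_functional R d.
have T_ge0 := @sphere_functional_ge0 R d.
pose f x := chi x ^+ 2.
have fq x : sphere d x -> f x = poly_eval (p * p) x.
  by move=> Sx; rewrite /f chip // poly_evalM expr2.
have IE : I = T (p * p) by exact: Rintegral_sphere fq.
have I_ge0 : 0 <= I by rewrite IE.
have := qmc m Mm f (sobolev_poly hd a basisY fq).
move=> /le_trans; apply.
(* Sizes are degrees plus one, so squaring sends n+1 to at most 2(n+1) - 1; the zero polynomial, of
   size 0, is treated apart. *)
have size_pp : (mpoly.mmeasure mpoly.mdeg (p * p) <= (2 * n).+1)%N.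
  have [->|p0] := eqVneq p 0; first by rewrite mul0r mpoly.mmeasure0.
  by rewrite mpoly.msizeM //; move: (mpoly.mmeasure _ p) pn => b; lia.
have quartic : A * T (p * p * (p * p)) <= (n.+1 ^ d.+1)%:R * I ^+ 2.
  rewrite IE /A -sphere_functional1.
  exact: (quartic_mpoly (ltnW hd : (1 < d.+1)%N) T_ge0 (sphere_functional_rot)).
have sqnorm_le : fine (sobolev_sqnorm a Y f) <=
    c1^-1 * ((2 * n%:R + 1) `^ s) ^+ 2 * T (p * p * (p * p)).
  rewrite (sobolev_sqnorm_poly hd a basisY fq size_pp) /=.
  (* Once the weights for l < 2n+1 are replaced by their common bound, Bessel's inequality for chi^2
     leaves its squared L^2 norm T(p^4). *)
  apply: le_trans (ler_wpM2l _ (harmonic_bessel hd basisY (2 * n).+1 (p * p))); last first.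
    by rewrite mulr_ge0 ?sqr_ge0 // invr_ge0 ltW.
  rewrite mulr_sumr; apply: ler_sum => l _; rewrite mulr_sumr; apply: ler_sum => k _.
  apply: weighted_sqnorm_le; rewrite ?sqr_ge0 //; first by rewrite -ltnS.
  by have /andP[] := hc1 l.
have dims : (n.+1 ^ d.+1)%:R <= K * ((dim_harm d n)%:R * (dim_harm d.+1 n)%:R) :> R.
  by rewrite -!natrM ler_nat; exact: dim_harm_mul_ge.
have norm_le : sobolev_norm a Y f <= mz_constant d c1 * (2 * n%:R + 1) `^ s *
    Num.sqrt ((dim_harm d n)%:R / A * (dim_harm d.+1 n)%:R) * I.
  rewrite -[leRHS]ger0_norm -?sqrtr_sqr; last first.
    by rewrite !mulr_ge0 ?sqrtr_ge0 ?powR_ge0.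
  apply: ler_wsqrtr; apply: le_trans sqnorm_le _.
  rewrite !exprMn !sqr_sqrtr; last 2 first.
  - by rewrite mulr_ge0 ?divr_ge0.
  - by rewrite divr_ge0 ?(ltW K_gt0) ?(ltW c1_gt0).
  set P := _ `^ s; rewrite -/K.
  have -> : K / c1 * P ^+ 2 * ((dim_harm d n)%:R / A * (dim_harm d.+1 n)%:R) * I ^+ 2 =
      c1^-1 * P ^+ 2 * (A^-1 * (K * ((dim_harm d n)%:R * (dim_harm d.+1 n)%:R) * I ^+ 2)).
    by ring.
  apply: ler_wpM2l; first by rewrite mulr_ge0 ?sqr_ge0 // invr_ge0 ltW.
  (* Clearing the area reduces the claim to the quartic inequality followed by the comparison [dims]
     of (n+1)^(d+1) with the dimensions. *)
  rewrite ler_pdivlMl //; apply: le_trans quartic _.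
  by rewrite ler_wpM2r ?sqr_ge0.
have cm_ge0 : 0 <= c / m%:R `^ (s / d%:R) by rewrite divr_ge0 ?powR_ge0 ?(ltW c_gt0).
apply: le_trans (ler_wpM2l cm_ge0 norm_le) _.
by rewrite /eta -/A le_eqVlt; apply/orP; left; apply/eqP; ring.
Qed.
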